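(* Let $r,k\ge 2$ be integers and let $b>0$. Let $(\mathcal H_n)_{n\in\mathbb N}$ be a sequence of $k$-uniform ordered hypergraphs and set $\hat p_n:=\hat p(\mathcal H_n)$. Consider the properties: (P1) $\hat p_n\to0$ and $\hat p_n v(\mathcal H_n)\to\infty$ as $n\to\infty$. (P2) $(\mathcal H_n)_{n\in\mathbb N}$ is $r$-supersaturated. (P3) For any $W\subseteq Y\subseteq[k]$ and any sufficiently large $n$, $\Delta_W(\mathcal H_{n,Y})\le b\,\frac{e(\mathcal H_{n,Y})}{e(\mathcal H_{n,W})}$. (P4) For any $W\subset Y\subseteq[k]$ with $|W|=1$ and any sufficiently large $n$, $\Delta_W(\mathcal H_{n,Y})\le b\,\frac{e(\mathcal H_{n,Y})}{v(\mathcal H_n)}$. (P5) There is a sequence $(X_n)_{n\in\mathbb N}$ of subsets $X_n\subseteq[k]$ with $|X_n|\ge3$ for all $n$ such that $f_{n,X_n}=\Omega(\hat p_n)$ and $\Delta_{W_n}(\mathcal H_{n,X_n})\cdot\Delta_{W_n'}(\mathcal H_{n,X_n})\cdot e(\mathcal H_{n,X_n})\cdot(\hat p_n)^{3|X_n|-2-|W_n'|}=o(1)$ for any sequences $(W_n),(W_n')$ with $W_n,W_n'\subsetneq X_n$, $|W_n|=2$ and $|W_n'|\ge2$. If (P1)–(P4) hold, then there is a constant $C>0$ such that if $q_n\ge C\hat p_n$ then $\lim_{n\to\infty}\mathbb P[\mathcal H^v_{n,q_n}\text{ is }r\text{-Ramsey}]=1$. If (P1) and (P3)–(P5) hold, then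 there is a constant $c>0$ such that if $q_n\le c\hat p_n$ then $\lim_{n\to\infty}\mathbb P[\mathcal H^v_{n,q_n}\text{ is }r\text{-Ramsey}]=0$.
   Context: A $k$-uniform ordered hypergraph $\mathcal H$ consists of a finite vertex set $V(\mathcal H)$ and a set $E(\mathcal H)$ of ordered $k$-tuples $(v_1,\dots,v_k)$ of pairwise distinct vertices; $v(\mathcal H)=|V(\mathcal H)|$, $e(\mathcal H)=|E(\mathcal H)|$. For $W=\{i_1<\dots<i_w\}\subseteq[k]$, the restriction $\mathcal H_W$ (written $\mathcal H_{n,W}$ for $\mathcal H=\mathcal H_n$) is the $w$-uniform ordered hypergraph on $V(\mathcal H)$ whose edge set is $\{(y_{i_1},\dots,y_{i_w}):(y_1,\dots,y_k)\in E(\mathcal H)\}$ (as a set, without multiplicities). For $W\subseteq Y\subseteq[k]$, $\Delta_W(\mathcal H_Y)$ is the maximum, over $f\in E(\mathcal H_W)$, of the number of edges $e\in E(\mathcal H_Y)$ such that deleting from $e$ the entries in the positions corresponding to $Y\setminus W$ gives $f$. For $W\subseteq[k]$, $f_{n,W}:=\big(e(\mathcal H_{n,W})/v(\mathcal H_n)\big)^{-1/(|W|-1)}$ and $\hat p(\mathcal H_n):=\max_{W\subseteq[k],|W|\ge2}f_{n,W}$. $\mathcal H^v_p$ is the random ordered hypergraph obtained by keeping each vertex of $\mathcal H$ independently with probability $p$ and keeping exactly those edges all of whose vertices are kept. $\mathcal H$ is $r$-Ramsey if every $r$-colouring of $V(\mathcal H)$ yields a monochromatic edge; $\mathcal H$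 is $(r,\varepsilon)$-supersaturated if every $r$-colouring of $V(\mathcal H)$ yields at least $\varepsilon e(\mathcal H)$ monochromatic edges; a sequence $(\mathcal H_n)$ is $r$-supersaturated if there exist $\varepsilon>0$ and $n_0$ such that $\mathcal H_n$ is $(r,\varepsilon)$-supersaturated for all $n\ge n_0$. *)

(* Defs.v *)
From mathcomp Require Import all_boot all_order all_algebra.
From mathcomp Require Import all_classical all_reals all_analysis.
Set Implicit Arguments.
Unset Strict Implicit.
Unset Printing Implicit Defensive.
Import Order.TTheory GRing.Theory Num.Theory numFieldNormedType.Exports.
Local Open Scope classical_set_scope.
Local Open Scope ring_scope.

Record ohgraph (k : nat) := OHGraph {
  vert : finType;
  edges : {set {ffun 'I_k -> vert}};
  edges_inj : forall e, e \in edges -> injective e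
}.

Section Hypergraph.
Variable k : nat.
Implicit Types (H : ohgraph k) (W Y : {set 'I_k}).

(* [enum_val] enumerates [W] in increasing order: its [j]-th value is the
   [j]-th smallest element of [W]. *)
Definition restr_edge (T : finType) W (e : {ffun 'I_k -> T}) :
  {ffun 'I_#|W| -> T} := [ffun j => e (enum_val j)].

Lemma restr_inj H W (f : {ffun 'I_#|W| -> vert H}) :
  f \in [set restr_edge W e | e in edges H]%SET -> injective f.
Proof.
case/imsetP => e eH ->; move=> i j; rewrite !ffunE => /(edges_inj eH).
exact: enum_val_inj.
Qed.

Definition restr H W : ohgraph #|W| := OHGraph (@restr_inj H W).

(* For [W \subset Y]: deleting from [e] the entries whose positions correspond
   to [Y :\: W] gives [f]. *)
Definition deletes_to (T : finType) W Y
    (e : {ffun 'I_#|Y| -> T}) (f : {ffun 'I_#|W| -> T}) : bool :=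
  [forall i : 'I_#|Y|, forall j : 'I_#|W|,
    (enum_val i == enum_val j) ==> (e i == f j)].

(* The maximum is 0 when there are no edges. *)
Definition Delta H W Y : nat :=
  \max_(f in edges (restr H W))
    #|[set e in edges (restr H Y) | deletes_to e f]%SET|.

Lemma induced_inj H (S : {set vert H})
    (e : {ffun 'I_k -> {x : vert H | x \in S}}) :
  e \in [set e : {ffun 'I_k -> {x : vert H | x \in S}}
          | [ffun i => val (e i)] \in edges H]%SET -> injective e.
Proof.
rewrite inE => /edges_inj inj_e i j eij.
by apply: inj_e; rewrite !ffunE eij.
Qed.

Definition induced H (S : {set vert H}) : ohgraph k :=
  OHGraph (@induced_inj H S).

Definition mono (T : finType) (r : nat) (c : {ffun T -> 'I_r})
    (e : {ffun 'I_k -> T}) : bool :=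
  [forall i, forall j, c (e i) == c (e j)].

Definition Ramsey (r : nat) H : bool :=
  [forall c : {ffun vert H -> 'I_r}, exists e in edges H, mono c e].

Section Real.
Variable R : realType.

Definition fW H W : R :=
  (#|edges (restr H W)|%:R / #|vert H|%:R) `^ (- (#|W|%:R - 1)^-1).

(* All the [fW H W] are nonnegative, so the default value 0 is harmless. When
   [H] has no edge, [phat H = 0]. *)
Definition phat H : R :=
  \big[Num.max/0]_(W : {set 'I_k} | (2 <= #|W|)%N) fW H W.

(* Probability that the random hypergraph obtained from [H] by keeping each
   vertex independently with probability [p] satisfies [A]. *)
Definition prob_keep H (p : R) (A : pred (ohgraph k)) : R :=
  \sum_(S : {set vert H} | A (induced S)) p ^+ #|S| * (1 - p) ^+ #|~: S|%SET.

Definition supersaturated (r : nat) (eps : R) H : Prop :=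
  forall c : {ffun vert H -> 'I_r},
    eps * #|edges H|%:R <= #|[set e in edges H | mono c e]%SET|%:R.

Variable Hn : nat -> ohgraph k.

Definition seq_supersaturated (r : nat) : Prop :=
  exists2 eps : R, 0 < eps &
    exists n0 : nat, forall n, (n0 <= n)%N -> supersaturated r eps (Hn n).

Definition P1 : Prop :=
  phat (Hn n) @[n --> \oo] --> 0 /\
  phat (Hn n) * #|vert (Hn n)|%:R @[n --> \oo] --> +oo.

Definition P2 (r : nat) : Prop := seq_supersaturated r.

Definition P3 (b : R) : Prop :=
  forall W Y, W \subset Y -> \forall n \near \oo,
    (Delta (Hn n) W Y)%:R
      <= b * (#|edges (restr (Hn n) Y)|%:R / #|edges (restr (Hn n) W)|%:R).

Definition P4 (b : R) : Prop :=
  forall W Y, W \proper Y -> #|W| = 1%N -> \forall n \near \oo,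
    (Delta (Hn n) W Y)%:R
      <= b * (#|edges (restr (Hn n) Y)|%:R / #|vert (Hn n)|%:R).

(* The natural-number subtractions are exact, since [#|W' n| < #|X n|]. *)
Definition P5 : Prop :=
  exists X : nat -> {set 'I_k},
    [/\ forall n, (3 <= #|X n|)%N,
        exists2 a : R, 0 < a &
          \forall n \near \oo, a * phat (Hn n) <= fW (Hn n) (X n)
      & forall W W' : nat -> {set 'I_k},
          (forall n, [/\ W n \proper X n, W' n \proper X n,
                         #|W n| = 2%N & (2 <= #|W' n|)%N]) ->
          (Delta (Hn n) (W n) (X n))%:R * (Delta (Hn n) (W' n) (X n))%:R
            * #|edges (restr (Hn n) (X n))|%:R
            * phat (Hn n) ^+ (3 * #|X n| - 2 - #|W' n|)
          @[n --> \oo] --> (0 : R)].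

End Real.
End Hypergraph.

(* Main.v *)
(* Upper half (hypergraph containers). Let [p] be [phat]. By (P3) and (P4) the
   number of edges with prescribed entries in a set [A] of positions is at most
   [b p^(|A|-1) e(H)/v(H)]. For an independent set [I], a greedy algorithm fixes
   the positions one after the other, choosing [O(p v(H))] vertices of [I] per
   position, and produces a set [D] disjoint from [I] and of linear size which
   depends only on the chosen vertices; iterating, the complement of [D] spans
   few edges. Given an [r]-colouring of the random set without monochromatic edge,
   supersaturation shows that the [r] sets [D] have a linear intersection, which
   the random set avoids. A union bound over the chosen vertices concludes.

   Lower half. Let [X] be as in (P5). If the random set does not admit a
   2-colouring of the edges of [H_X], take an inclusion-minimal non-2-colourable
   family [F] of edges. For every [e] in [F] and [v] in [e] there is [f] in [F]
   with [f] meeting [e] exactly in [v]. Following a longest loose path, this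
   yields a structure in which all but two edges extend a loose path, while two
   edges meet what came before in [a] and [b] vertices, with [2 <= a, b < |X|]
   and [2] among [a, b]; the Pasch configuration is the only obstacle and is
   treated by hand. Loose paths are subcritical for small [c], so the expected
   number of such structures is bounded by the quantity in (P5). *)
Require Import Defs.
From mathcomp Require Import all_boot all_order all_algebra.
From mathcomp Require Import zify ring lra reals sequences exp.
Set Implicit Arguments.
Unset Strict Implicit.
Unset Printing Implicit Defensive.

(** * Minimal non-2-colourable set systems *)

(** Each of the two extra edges contributes an expected factor [D a * q ^+ (x - a)] with [x = |X|],
    where [D a] bounds the number of edges through [a] given vertices. With the starting edge, the
    exponents of [q] add up to [3x - a - b], which is the exponent in (P5) once one of [a], [b] is
    2. As (P5) speaks of proper subsets of [X], an edge all of whose vertices are already visited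
    cannot be used. The Pasch configuration [uva, ayz, uyr, vzr] runs into exactly this: three lines
    cover the fourth. It is 2-colourable, so a minimal system closed on its six points has a further
    edge there, and this edge yields the structure. The paths have unbounded length, so a path step
    may only attach to the last edge, which leaves [x] choices of the vertex. The few steps that
    attach anywhere have polynomially many choices in the length, and geometric decay absorbs them.
    In the upper half the danger is that the edges collected greedily pile up on few tuples. An edge
    is collected only while the degrees of all its tuples at free positions are below thresholds, so
    the degree condition passes to the next position with a larger constant. *)

Section TwoColouring.
Variable V : finType.
Implicit Types (F : {set {set V}}) (U l e f g T : {set V}) (p q : seq {set V}).

Definition colourable F :=
  [exists T : {set V}, forall e in F, (e :&: T != set0) && (e :\: T != set0)].

Definition critical F := ~~ colourable F /\ forall e, e \in F -> colourable (F :\ e).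

Lemma critical_subset F : ~~ colourable F -> exists2 F' : {set {set V}}, F' \subset F & critical F'.
Proof.
have [n] := ubnP #|F|; elim: n F => // n IH F ltn ncF.
have [/exists_inP[e eF ncFe]|/exists_inPn h] := boolP [exists e in F, ~~ colourable (F :\ e)].
  have [|F' sF' cF'] := IH _ _ ncFe; first by move: ltn; rewrite (cardsD1 e) eF; lia.
  by exists F' => //; apply: subset_trans sF' (subD1set _ _).
by exists F => //; split=> // e /h; rewrite negbK.
Qed.

(* In a 2-colouring of [F :\ e] the edge [e] is monochromatic; recolouring
   [v] has to create another monochromatic edge. *)
Lemma critical_meet F e v : critical F -> (forall g, g \in F -> 1 < #|g|) ->
  e \in F -> v \in e -> exists2 f, f \in F & f :&: e = [set v].
Proof.
move=> [ncF cF] big eF ve.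
have [T [hT eT]] : exists T, (forall g, g \in F :\ e ->
    (g :&: T != set0) && (g :\: T != set0)) /\ e \subset T.
  have /existsP[T /forall_inP hT] := cF _ eF.
  have [eT|neT] := boolP (e \subset T); first by exists T.
  exists (~: T); split=> [g /hT|].
    by rewrite !setDE setCK andbC.
  rewrite -disjoints_subset -setI_eq0; apply: contraNT ncF => eT.
  apply/existsP; exists T; apply/forall_inP => g gF.
  have [->|ge] := eqVneq g e; first by rewrite eT setD_eq0.
  by apply: hT; rewrite !inE ge.
have [/exists_inP[f fF mf]|/exists_inPn h] := boolP [exists f in F,
    (f :&: (T :\ v) == set0) || (f :\: (T :\ v) == set0)]; last first.
  case/negP: ncF; apply/existsP; exists (T :\ v).
  by apply/forall_inP => f /h; rewrite negb_or.
have fe : f != e.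
  apply: contraTneq mf => ->; rewrite negb_or; apply/andP; split.
    have := big _ eF; rewrite (cardsD1 v) ve ltnS => /card_gt0P[w].
    rewrite !inE => /andP[wv we]; apply/set0Pn; exists w.
    by rewrite !inE we wv (subsetP eT).
  by apply/set0Pn; exists v; rewrite !inE eqxx ve.
have /andP[h1 h2] : (f :&: T != set0) && (f :\: T != set0).
  by apply: hT; rewrite !inE fe.
have vf : v \in f.
  apply: contraLR mf => vf; rewrite negb_or.
  have tt z : z \in f -> (z \in T :\ v) = (z \in T).
    by move=> zf; rewrite !inE; case: eqP zf vf => // -> ->.
  case/set0Pn: h1 => z1; rewrite inE => /andP[z1f z1T].
  case/set0Pn: h2 => z2; rewrite inE => /andP[z2f z2T].
  apply/andP; split; apply/set0Pn.
    by exists z1; rewrite inE tt // z1f.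
  by exists z2; rewrite inE tt // z2f.
exists f => //; apply/setP => z; rewrite !inE; apply/andP/eqP => [[zf ze]|->//].
apply/eqP; case/orP: mf => /eqP/setP.
  by move=> /(_ z); rewrite !inE zf (subsetP eT z ze) andbT /= => /negbFE.
by move=> /(_ v); rewrite !inE eqxx vf.
Qed.

Lemma setI_eq1 (A B : {set V}) v : A :&: B = [set v] ->
  [/\ v \in A, v \in B & forall w, w \in A -> w \in B -> w = v].
Proof.
move=> AB; have : v \in A :&: B by rewrite AB inE.
rewrite inE => /andP[vA vB]; split=> // w wA wB; apply/eqP.
by rewrite -in_set1 -AB inE wA.
Qed.

(* Step [0] continues a loose path from its last edge [l]; a step [a > 0] may
   attach [g] anywhere. Only the former occurs an unbounded number of times, so
   that the number of ways to grow a structure stays geometric. *)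
Definition attaches (a : nat) U l g :=
  if a is 0 then (#|g :&: U| == 1) && (g :&: U \subset l) else #|g :&: U| == a.

Lemma attaches_jump a U l g : 0 < a -> #|g :&: U| = a -> attaches a U l g.
Proof. by case: a => //= a _ ->. Qed.

Fixpoint grows F (w : seq nat) U l : bool :=
  if w is a :: w' then
    [exists g in F, attaches a U l g && grows F w' (U :|: g) g]
  else true.

Arguments grows : simpl never.

Lemma grows_consP F a w U l : reflect
  (exists g, [/\ g \in F, attaches a U l g & grows F w (U :|: g) g])
  (grows F (a :: w) U l).
Proof.
apply: (iffP exists_inP) => [[g gF /andP[]]|[g [gF ag gr]]]; first by exists g.
by exists g => //; apply/andP.
Qed.

Lemma growsS F F' w U l : F \subset F' -> grows F w U l -> grows F' w U l.
Proof.
move=> sF; elim: w U l => // a w IH U l /grows_consP[g [gF ag gr]].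
by apply/grows_consP; exists g; split; [exact: (subsetP sF) | | exact: IH].
Qed.

Lemma grows_cons F a w U l g : g \in F -> attaches a U l g ->
  grows F w (U :|: g) g -> grows F (a :: w) U l.
Proof. by move=> gF ag gr; apply/grows_consP; exists g. Qed.

(* A loose path, an edge meeting it in [a] vertices, another loose path (which
   may start anywhere if [eps]), and an edge meeting all this in [b] vertices. *)
Definition spread n1 a (eps : bool) n2 b : seq nat :=
  nseq n1 0 ++ a :: nseq eps 1 ++ nseq n2 0 ++ [:: b].

(** The cap [2 ^ #|V|] on the lengths only makes the later union bound range over a finite type; the
    decay in [n1] and [n2] makes its size immaterial. *)
Definition dense_in F x := exists n1 a eps n2 b,
  [/\ n1 <= 2 ^ #|V|, n2 <= 2 ^ #|V|, (2 <= a < x) && (2 <= b < x), (a == 2) || (b == 2)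
   & exists2 g, g \in F & grows F (spread n1 a eps n2 b) g g].

Lemma dense_inI F x n1 a (eps : bool) n2 b g : n1 <= 2 ^ #|V| -> n2 <= 2 ^ #|V| ->
  2 <= a < x -> 2 <= b < x -> (a == 2) || (b == 2) -> g \in F ->
  grows F (spread n1 a eps n2 b) g g -> dense_in F x.
Proof. by move=> *; exists n1, a, eps, n2, b; split=> //; [apply/andP | exists g]. Qed.

(** * Loose paths *)

Definition cov p : {set V} := [set v | has (fun g : {set V} => v \in g) p].

Lemma in_cov p v : (v \in cov p) = has (fun g : {set V} => v \in g) p.
Proof. by rewrite inE. Qed.

Lemma covP p v : reflect (exists2 g, g \in p & v \in g) (v \in cov p).
Proof. by rewrite in_cov; apply: (iffP hasP). Qed.

(** A path is prolonged at its head, as [f :: p], so that maximality concerns one end only. *)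
Fixpoint loose F p : bool :=
  if p is e :: q then [&& e \in F, loose F q &
    if q is e' :: q' then
      (#|e :&: e'| == 1) && all (fun g : {set V} => [disjoint e & g]) q'
    else true]
  else true.

Lemma loose_sub F p : loose F p -> {subset p <= F}.
Proof.
elim: p => //= e q IH /and3P[eF lq _] g; rewrite inE => /orP[/eqP->//|].
exact: IH.
Qed.

Lemma loose_uniq F p : (forall g, g \in F -> 1 < #|g|) -> loose F p -> uniq p.
Proof.
move=> big; elim: p => //= e q IH /and3P[eF lq h]; rewrite (IH lq) andbT.
have ge := big _ eF.
case: q h {IH lq} => // e' q /andP[c1 al]; rewrite inE negb_or; apply/andP; split.
  by apply: contraTneq ge => ee; move: c1; rewrite -ee setIid => /eqP->.
apply/negP => /(allP al); rewrite -setI_eq0 setIid => /eqP e0.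
by move: ge; rewrite e0 cards0.
Qed.

Lemma loose_rcons2 F p e g : loose F (rcons (rcons p e) g) ->
  [/\ loose F (rcons p e), g \in F, #|g :&: e| = 1 &
      all (fun h : {set V} => [disjoint g & h]) p].
Proof.
elim: p => [|f p IH] /=.
  by case/and3P=> eF /andP[gF _] /andP[/eqP c _]; rewrite eF gF setIC.
case/and3P=> fF /IH[lp gF c al] h; split=> //; rewrite ?fF ?lp ?al /=.
  by case: p h {IH lp al} => [|f' p] /= /andP[-> //]; rewrite all_rcons => /andP[_ ->].
rewrite andbT; case: p h {IH lp al} => [|f' p] /= /andP[_].
  by rewrite andbT disjoint_sym.
by rewrite all_rcons => /andP[]; rewrite disjoint_sym.
Qed.

Lemma loose_catl F p q : loose F (p ++ q) -> loose F p.
Proof.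
elim: p => //= e p IH /and3P[-> /IH-> /=].
by case: p {IH} => //= e' p /andP[->]; rewrite all_cat => /andP[].
Qed.

Lemma disjoint_meetF (A B : {set V}) v : [disjoint A & B] -> v \in A -> v \in B -> False.
Proof. by move=> /pred0P/(_ v) /= + vA vB; rewrite vA vB. Qed.

(** By looseness only the first edge of [p] meets [l], so the later ones miss [U] altogether and
    meet the enlarged structure inside their predecessor. Hence every step is a step [0]. *)
Lemma grows_loose F p w U l : loose F (l :: p) ->
  (forall g, g \in p -> g :&: U \subset l) -> l \subset U ->
  grows F w (U :|: cov p) (last l p) -> grows F (nseq (size p) 0 ++ w) U l.
Proof.
elim: p U l => [|g p IH] U l /=.
  by move=> _ _ _; rewrite (_ : U :|: _ = U) //; apply/setP => z; rewrite !inE orbF.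
move=> /and3P[lF /and3P[gF lp hp] /andP[c al]] hU lU gr.
have gU : g :&: U = l :&: g.
  apply/setP => z; rewrite !inE andbC; apply/andP/andP => -[h1 h2]; split=> //.
    by apply: (subsetP (hU g _)); rewrite ?inE ?eqxx ?h1 ?h2.
  exact: (subsetP lU).
have aa : attaches 0 U l g by rewrite /= gU c subsetIl.
apply: (grows_cons gF aa); apply: IH => /=.
- by rewrite gF lp.
- move=> h hp'; rewrite setIUr subUset subsetIr andbT.
  apply/subsetP => z /[dup] /(subsetP (hU h _)) zl; rewrite inE => /andP[zh _].
  by case: (disjoint_meetF (allP al h hp') (zl _) zh); rewrite inE hp' orbT.
- exact: subsetUr.
- by rewrite (_ : U :|: g :|: _ = U :|: cov (g :: p)) //; apply/setP => z; rewrite !inE /= orbA.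
Qed.

(** * Chains and cycles in a uniform system *)

Section Critical.
Variables (F : {set {set V}}) (x : nat).
Hypotheses (x3 : 2 < x) (unifF : forall g, g \in F -> #|g| = x).
Hypothesis meetF : forall e v, e \in F -> v \in e -> exists2 f, f \in F & f :&: e = [set v].

(* The chain leaves [U] through [l]; it must come back, and it does so before
   the last edge if its last edge is contained in what has been visited. *)
Lemma grows_return U l' l : l \in F -> #|l :&: U| = 1 -> l :&: U \subset l' ->
  exists n b, [/\ n <= #|V|, 2 <= b < x & grows F (nseq n 0 ++ [:: b]) U l'].
Proof.
move=> lF c1 sl.
suff [n [b [ln hb gr]]] : exists n b,
    [/\ n <= #|~: U|, 2 <= b < x & grows F (nseq n 0 ++ [:: b]) U l'].
  by exists n, b; split=> //; apply: leq_trans ln (max_card _).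
move: lF c1 sl; have [m] := ubnP #|~: U|; elim: m U l' l => // m IH U l' l ltm lF c1 sl.
have clU : #|l :\: U| = x.-1 by have := cardsID U l; rewrite c1 (unifF lF); lia.
have [u] : exists u, u \in l :\: U by apply/card_gt0P; rewrite clU; lia.
rewrite inE => /andP[uU ul].
have [f fF fl] := meetF lF ul.
have [uf _ _] := setI_eq1 fl.
have al : attaches 0 U l' l by rewrite /= c1 eqxx.
have fUl : f :&: (U :|: l) = u |: (f :&: U) by rewrite setIUr fl setUC.
have cfU : #|f :&: (U :|: l)| = (#|f :&: U|).+1.
  by rewrite fUl cardsU1 inE (negbTE uU) andbF.
have ltC : #|~: (U :|: l)| < #|~: U|.
  apply: proper_card; rewrite setCU properE subsetIl /=.
  by apply/subsetPn; exists u; rewrite !inE // ul andbF.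
have [fU0|fU0] := eqVneq (f :&: U) set0.
  have [||||n [b [ln hb gr]]] := IH (U :|: l) l f.
  - by apply: leq_trans ltC _; rewrite -ltnS.
  - by [].
  - by rewrite cfU fU0 cards0.
  - by rewrite fUl fU0 setU0 sub1set.
  exists n.+1, b; split=> //=.
    exact: leq_ltn_trans ln ltC.
  exact: (grows_cons lF al).
have fU1 : 0 < #|f :&: U| by rewrite card_gt0.
have u0 : 0 < #|~: U| by apply/card_gt0P; exists u; rewrite inE.
have [lt|ge] := ltnP #|f :&: (U :|: l)| x.
  exists 1, #|f :&: (U :|: l)|; split=> //; first by rewrite lt cfU; lia.
  by apply: (grows_cons lF al); apply: (grows_cons fF) => //; apply: attaches_jump; rewrite // cfU.
have fx : #|f :&: U| = x.-1.
  by have := subset_leq_card (subsetIl f (U :|: l)); rewrite (unifF fF) cfU; lia.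
exists 0, x.-1; split=> //; first by lia.
by apply: (grows_cons fF) => //; apply: attaches_jump => //; lia.
Qed.

Lemma grows_escape U l g : g \in F -> g :&: U != set0 -> ~~ (g \subset U) ->
  exists eps n b, [/\ n <= #|V|, 2 <= b < x &
    grows F (nseq (eps : bool) 1 ++ nseq n 0 ++ [:: b]) U l].
Proof.
move=> gF gU ngU; rewrite -card_gt0 in gU.
have lt : #|g :&: U| < x.
  rewrite -(unifF gF); apply: proper_card; rewrite properE subsetIl /=.
  by apply: contra ngU; rewrite subsetI subxx.
have [c1|c2] := leqP #|g :&: U| 1; last first.
  exists false, 0, #|g :&: U|; rewrite lt c2; split=> //.
  by apply: (grows_cons gF) => //; apply: attaches_jump.
have {}c1 : #|g :&: U| = 1 by lia.
(* With [U] in the role of the last edge, the containment demanded by a step [0] is vacuous; the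
   first step of the chain can thus be read as a step [1] from any [l]. *)
have [n [b [ln hb gr]]] := grows_return gF c1 (subsetIr g U).
case: n ln gr => [|n] ln gr.
  exists false, 0, b; split=> //; case/grows_consP: gr => h [hF ah _].
  by apply: (grows_cons hF) => //; case: b hb ah.
exists true, n, b; split=> //; first exact: ltnW.
case/grows_consP: gr => h [hF /andP[h1 _] gr].
exact: (grows_cons hF).
Qed.

Lemma loose_size p : loose F p -> size p <= 2 ^ #|V|.
Proof.
move=> lp; have /card_uniqP <- : uniq p.
  by apply: loose_uniq lp => g /unifF->; apply: ltn_trans x3.
by rewrite -cardsT -card_powerset powersetT cardsT max_card.
Qed.

Lemma loose_cov e p g q : loose F (e :: p ++ g :: q) ->
  [/\ g :&: cov (e :: p) = g :&: last e p, #|g :&: cov (e :: p)| = 1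
    & all (fun h : {set V} => [disjoint g & h]) (belast e p)].
Proof.
move=> lp; have {lp} : loose F (rcons (rcons (belast e p) (last e p)) g).
  by rewrite -lastI -cats1; apply: (@loose_catl _ _ q); rewrite -catA.
move=> /loose_rcons2[_ gF c al].
have eI : g :&: cov (e :: p) = g :&: last e p.
  apply/setP => z; rewrite !in_setI; case zg: (z \in g) => //=; rewrite lastI in_cov has_rcons.
  case: hasP => [[h hp zh]|//]; last by rewrite orbF.
  by case: (disjoint_meetF (allP al _ hp) zg zh).
by rewrite eI.
Qed.

Lemma loose_max : F != set0 ->
  exists p, [/\ loose F p, p != [::] & forall f, ~~ loose F (f :: p)].
Proof.
case/set0Pn => e0 e0F.
suff H n p : 2 ^ #|V| - size p < n -> loose F p -> p != [::] ->
    exists p, [/\ loose F p, p != [::] & forall f, ~~ loose F (f :: p)].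
  by apply: (H _ [:: e0] (ltnSn _)) => //=; rewrite e0F.
elim: n p => // n IH p ltn lp pn.
have [/existsP[f lf]|/existsPn h] := boolP [exists f, loose F (f :: p)]; last by exists p.
by apply: (IH (f :: p)) => //; have := loose_size lf; move: ltn => /=; lia.
Qed.

Lemma has_first (a : pred {set V}) p : has a p ->
  exists p1 g p2, [/\ p = p1 ++ g :: p2, a g & all (predC a) p1].
Proof.
elim: p => //= g p IH; have [ag _|ag /= /IH[p1 [h [p2 [-> ah al]]]]] := boolP (a g).
  by exists [::], g, p.
by exists (g :: p1), h, p2; rewrite /= ag.
Qed.

Definition closed_in U := forall g, g \in F -> g :&: U != set0 -> g \subset U.

(** Let [ei] be the first edge of [rest] hit by [f], so that [f], [e1], [p1], [ei] close up. If [f]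
    meets [ei] twice or more, reading this cycle from [ei] gives the structure. If it meets [ei]
    once and some edge leaves the union, reading the cycle from [f], with [ei] attached in two
    vertices, and then escaping along that edge gives it. Otherwise the union is closed, which
    forces the path to end at [ei]. *)
Lemma cycle_or_dense e1 rest u f : loose F (e1 :: rest) -> u \in e1 ->
  u \notin head set0 rest -> f \in F -> f :&: e1 = [set u] ->
  ~~ loose F (f :: e1 :: rest) ->
  dense_in F x \/ exists p1 ei y, [/\ rest = rcons p1 ei,
    all (fun g : {set V} => [disjoint f & g]) p1, f :&: ei = [set y], u \notin ei
    & closed_in (f :|: e1 :|: cov p1 :|: ei)].
Proof.
move=> lp ue1 uh fF fe1 nl.
have [uf _ fe1u] := setI_eq1 fe1.
have e1F : e1 \in F by case/andP: lp.
have uR g : g \in rest -> u \notin g.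
  case: rest uh lp {nl} => //= g0 r uh /and3P[_ _ /andP[_ al]].
  rewrite inE => /orP[/eqP->//|/(allP al) d].
  by apply/negP => /(disjoint_meetF d ue1).
have : has (fun g : {set V} => ~~ [disjoint f & g]) rest.
  rewrite has_predC; apply: contra nl => al.
  by rewrite [loose _ _]/= -/(loose F (e1 :: rest)) fF lp fe1 cards1 al.
case/has_first=> p1 [ei [p2 [er hit al]]].
have {}al : all (fun g : {set V} => [disjoint f & g]) p1.
  by apply: sub_all al => g /=; rewrite negbK.
rewrite er in lp uR.
have eiF : ei \in F.
  by apply: (loose_sub lp); rewrite !inE mem_cat inE eqxx !orbT.
have uei : u \notin ei by apply: uR; rewrite mem_cat inE eqxx orbT.
have [eicov ceicov dei] := loose_cov lp.
have lp1 : loose F (e1 :: p1) by apply: (@loose_catl _ _ (ei :: p2)).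
have sp1 : size p1 <= 2 ^ #|V| by apply: leq_trans (loose_size lp1).
have sp1' : size p1 < 2 ^ #|V| by apply: leq_trans (loose_size lp1).
have hit0 : 0 < #|f :&: ei| by rewrite card_gt0 setI_eq0.
have cx : #|f :&: ei| < x.
  rewrite -(unifF fF); apply: proper_card; rewrite properE subsetIl /=.
  by apply/subsetPn; exists u; rewrite // inE negb_and uei orbT.
have [s2|s1] := ltnP 1 #|f :&: ei|.
  left; have att : attaches #|f :&: ei| ei ei f.
    exact: attaches_jump.
  (* The cycle is read as [ei], [f], [e1], [p'], [g]. The last edge [g] closes it with one vertex in
     the end of the path and one in [ei]; when [p1] is empty, [e1] plays this role with [u] and its
     common vertex with [ei]. *)
  case/lastP: p1 => [|p' g] in er lp uR al eicov ceicov dei lp1 sp1 sp1' *.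
    apply: (@dense_inI _ _ 0 #|f :&: ei| false 0 2 ei); rewrite ?s2 ?orbT //.
    apply: (grows_cons fF att); apply: (grows_cons e1F) => //=.
    rewrite setIUr [e1 :&: f]setIC fe1 setUC cardsU1 inE (negbTE uei) andbF /=.
    by move: ceicov; rewrite eicov /= setIC => ->.
  apply: (@dense_inI _ _ 0 #|f :&: ei| false (size p').+1 2 ei);
    rewrite ?s2 ?orbT //.
    by move: sp1'; rewrite size_rcons => /ltnW.
  rewrite /spread /=.
  apply: (grows_cons fF att).
  have dei1 : [disjoint ei & e1].
    by apply: (allP dei); rewrite belast_rcons inE eqxx.
  have fe1' : e1 :&: (ei :|: f) = [set u].
    by rewrite setIUr [e1 :&: ei]setIC (disjoint_setI0 dei1) set0U setIC.
  apply: (grows_cons e1F); first by rewrite /= fe1' cards1 sub1set.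
  have lp' : loose F (e1 :: p') by apply: (@loose_catl _ _ [:: g]); rewrite /= cats1.
  have gin : g \in rcons p' g by rewrite mem_rcons inE eqxx.
  have gF : g \in F by apply: (loose_sub lp1); rewrite inE gin orbT.
  apply: (grows_loose lp'); rewrite ?subsetUr //.
    move=> h hp'; have hr : h \in rcons p' g by rewrite mem_rcons inE hp' orbT.
    rewrite setIUr subUset subsetIr andbT; apply/subsetP => z.
    rewrite !inE => /andP[zh /orP[zei|zf]].
      case: (disjoint_meetF (allP dei h _) zei zh).
      by rewrite belast_rcons inE hp' orbT.
    by case: (disjoint_meetF (allP al h hr) zf zh).
  have [gcov cgcov dg] : [/\ g :&: cov (e1 :: p') = g :&: last e1 p',
      #|g :&: cov (e1 :: p')| = 1
    & all (fun h : {set V} => [disjoint g & h]) (belast e1 p')].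
    by apply: (@loose_cov _ _ _ [::]); rewrite cats1.
  have gei : #|g :&: ei| = 1 by move: ceicov; rewrite eicov last_rcons setIC.
  apply: (grows_cons gF) => //.
  have -> : ei :|: f :|: e1 :|: cov p' = f :|: (ei :|: cov (e1 :: p')).
    by apply/setP => z; rewrite !inE; do !case: (z \in _) => //=.
  rewrite /= setIUr [g :&: f]setIC (disjoint_setI0 (allP al g gin)).
  rewrite set0U setIUr cardsU gei cgcov gcov.
  suff -> : g :&: ei :&: (g :&: last e1 p') = set0 by rewrite cards0.
  apply/eqP; rewrite -subset0; apply/subsetP => z; rewrite !inE.
  move=> /andP[/andP[_ zei] /andP[_ zl]].
  case: (disjoint_meetF (allP dei (last e1 p') _) zei zl).
  by rewrite belast_rcons mem_last.
have /cards1P[y fei] : #|f :&: ei| == 1 by rewrite eqn_leq s1.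
have [yf yei _] := setI_eq1 fei.
have ynl : y \notin cov (e1 :: p1).
  apply/covP => -[h]; rewrite inE => /orP[/eqP->|hp1] yh.
    by move: uei; rewrite -(fe1u y yf yh) yei.
  by case: (disjoint_meetF (allP al h hp1) yf yh).
set U := f :|: e1 :|: cov p1 :|: ei.
have [/exists_inP[g gF /andP[gU ngU]]|/exists_inPn cl] :=
    boolP [exists g in F, (g :&: U != set0) && ~~ (g \subset U)].
  left; have [eps [n [b [ln hb gr]]]] := grows_escape ei gF gU ngU.
  apply: (@dense_inI _ _ (size p1).+1 2 eps n b f) => //.
    by apply: leq_trans ln (ltnW (ltn_expl _ _)).
  rewrite /spread /=; apply: (grows_cons e1F).
    by rewrite /= setIC fe1 cards1 sub1set.
  apply: (grows_loose lp1); rewrite ?subsetUr //.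
    move=> h hp1; rewrite setIUr subUset subsetIr andbT; apply/subsetP => z.
    rewrite !inE => /andP[zh zf].
    by case: (disjoint_meetF (allP al h hp1) zf zh).
  apply: (grows_cons eiF) => //.
  have -> : f :|: e1 :|: cov p1 = f :|: cov (e1 :: p1).
    by apply/setP => z; rewrite !inE /= orbA.
  rewrite /= setIUr [ei :&: f]setIC fei cardsU1 ceicov inE (negbTE ynl) andbF //.
right; exists p1, ei, y.
have clU : closed_in U.
  by move=> g gF gU; move: (cl g gF); rewrite gU /= negbK.
(* An edge [g] following [ei] lies in the closed union, meets [ei] once and avoids [e1] and [p1];
   its other vertices lie in [f] without [u] and [y], which leaves at most [x - 1] vertices for
   [g]. *)
split=> //; rewrite er; case: p2 => [|g p2] in er lp uR *; first by rewrite cats1.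
have lp2 : loose F (e1 :: rcons p1 ei ++ g :: p2) by rewrite cat_rcons.
have [gcov cgcov dg] := loose_cov lp2.
rewrite last_rcons in gcov; rewrite belast_rcons in dg.
have gF : g \in F by apply: (loose_sub lp2); rewrite !inE mem_cat inE eqxx !orbT.
have ug : u \notin g by apply: uR; rewrite mem_cat !inE eqxx !orbT.
have gei : #|g :&: ei| = 1 by rewrite -gcov.
have gU : g \subset U.
  apply: clU => //; have : g :&: ei != set0 by rewrite -card_gt0 gei.
  by case/set0Pn=> z; rewrite inE => /andP[zg zei]; apply/set0Pn; exists z; rewrite !inE zg zei !orbT.
have : g \subset (g :&: ei) :|: ((f :\ u) :\ y).
  apply/subsetP => z zg; have := subsetP gU z zg; rewrite !inE zg /=.
  case zei: (z \in ei) => //=; rewrite orbF => zU.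
  have -> : z != y by apply: contraFneq zei => ->.
  have -> : z != u by apply: contraTneq zg => ->.
  case: (z \in f) zU => //=; rewrite -in_cov => zU.
  have /covP[h hp zh] : z \in cov (e1 :: p1) by rewrite in_cov /= -in_cov.
  by case: (disjoint_meetF (allP dg h hp) zg zh).
move=> /subset_leq_card /leq_trans/(_ (leq_card_setU _ _)); rewrite gei.
have := unifF fF; rewrite (cardsD1 u) uf (cardsD1 y) !inE yf andbT.
have -> : y != u by apply: contraNneq uei => <-.
by rewrite (unifF gF) /=; move: (#|_|) => n; clear; lia.
Qed.
End Critical.

(** * The Pasch configuration *)

Lemma card_seqI (s : seq V) (A : {set V}) : uniq s ->
  #|[set w in s] :&: A| = count (fun w => w \in A) s.
Proof.
elim: s => [|w s IH] /=; first by move=> _; apply/eqP; rewrite cards_eq0 -subset0; apply/subsetP => z; rewrite !inE.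
case/andP=> ws us; rewrite set_cons setIUl cardsU IH //.
have -> : #|[set w] :&: A| = (w \in A).
  case wA: (w \in A); first by rewrite (setIidPl _) ?cards1 ?sub1set.
  by apply/eqP; rewrite cards_eq0 setI_eq0 disjoints1 wA.
suff -> : [set w] :&: A :&: ([set:: s] :&: A) = set0 by rewrite cards0 subn0.
by apply/setP => z; rewrite !inE; case: eqP => //= ->; rewrite (negbTE ws) andbF.
Qed.

(** The four lines alone are 2-colourable, so [F] has a fifth edge [f] on the six points. It has
    three points and is no line; starting from [f], two suitable lines attach in two vertices
    each. *)
Lemma pasch_dense F u v a y z r : critical F -> (forall g, g \in F -> #|g| = 3) ->
  uniq [:: u; v; a; y; z; r] ->
  [set w in [:: u; v; a]] \in F -> [set w in [:: a; y; z]] \in F ->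
  [set w in [:: u; y; r]] \in F -> [set w in [:: v; z; r]] \in F ->
  closed_in F [set w in [:: u; v; a; y; z; r]] -> dense_in F 3.
Proof.
move=> [ncF cF] unifF un L1 L2 L3 L4 cl; set U := [set w in _] in cl.
pose lines := [:: [set w in [:: u; v; a]]; [set w in [:: a; y; z]];
                  [set w in [:: u; y; r]]; [set w in [:: v; z; r]]].
have [f [fF fU fl]] : exists f, [/\ f \in F, f \subset U & f \notin lines].
  have [/exists_inP[f fF /andP[? ?]]|/exists_inPn h] :=
    boolP [exists f in F, (f \subset U) && (f \notin lines)]; first by exists f.
  case/negP: ncF; have /existsP[T /forall_inP hT] := cF _ L1.
  (* The colouring [T] of [F] without the line [uva] is kept outside [U]; inside, [u] and [z]
     against the other four points split every line. *)
  apply/existsP; exists ((T :\: U) :|: [set w in [:: u; z]]).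
  apply/forall_inP => g gF.
  have [gU|gU] := eqVneq (g :&: U) set0.
    have gL : g \in F :\ [set w in [:: u; v; a]].
      rewrite !inE gF andbT; apply: contra_eq_neq gU => ->.
      by apply/set0Pn; exists u; rewrite !inE eqxx.
    have gT w : w \in g -> (w \in (T :\: U) :|: [set w in [:: u; z]]) = (w \in T).
      move=> wg; have wU : w \notin U by apply/negP => wU; move/setP/(_ w): gU; rewrite in_setI wg wU inE.
      rewrite in_setU in_setD wU /= -[RHS]orbF; congr (_ || _).
      by apply: contraNF wU; rewrite !inE => /orP[]/eqP->; rewrite eqxx ?orbT.
    have /andP[/set0Pn[w1 h1] /set0Pn[w2 h2]] := hT g gL.
    move: h1 h2; rewrite in_setI in_setD => /andP[g1 t1] /andP[n2 g2].
    apply/andP; split; apply/set0Pn.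
      by exists w1; rewrite in_setI g1 gT.
    by exists w2; rewrite in_setD g2 gT ?n2.
  have := h g gF; rewrite (cl g gF gU) /= negbK => gl.
  move: un; rewrite /= !inE !negb_or -!andbA.
  move=> /and5P[uv ua uy uz /and5P[ur va vy vz /and5P[vr ay az ar /and4P[yz yr zr _]]]].
  have := gl; rewrite /lines !inE => /or4P[] /eqP-> {h gl gF gU g};
    apply/andP; split; apply/set0Pn.
  - by exists u; rewrite !inE eqxx /= ?orbT.
  - by exists v; rewrite !inE eqxx (eq_sym v u) (negbTE uv) (negbTE vz) /= ?orbT.
  - by exists z; rewrite !inE eqxx /= ?orbT.
  - by exists a; rewrite !inE eqxx (eq_sym a u) (negbTE ua) (negbTE az) /= ?orbT.
  - by exists u; rewrite !inE eqxx /= ?orbT.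
  - by exists y; rewrite !inE eqxx (eq_sym y u) (negbTE uy) (negbTE yz) /= ?orbT.
  - by exists z; rewrite !inE eqxx /= ?orbT.
  - by exists v; rewrite !inE eqxx (eq_sym v u) (negbTE uv) (negbTE vz) /= ?orbT.
(* The line [cdh] meets [f] twice; then [cmn] meets what is visited in [c] and in exactly one of
   [m], [n]. *)
have step c d h m n (G G' : {set V}) : uniq [:: c; d; h; m; n] -> G =i [:: c; d; h] -> G' =i [:: c; m; n] ->
    G \in F -> G' \in F -> (c \in f) + (d \in f) + (h \in f) = 2 ->
    (m \in f) + (n \in f) = 1 -> dense_in F 3.
  move=> unc eG eG' GF G'F s2 s1.
  have e1 : G = [set w in [:: c; d; h]] by apply/setP => w; rewrite eG !inE.
  have e2 : G' = [set w in [:: c; m; n]] by apply/setP => w; rewrite eG' !inE.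
  apply: (@dense_inI _ _ 0 2 false 0 2 f) => //.
  move: unc; rewrite /= !inE !negb_or -!andbA.
  move=> /and5P[cd ch cm cn /and5P[dh dm dn hm /and3P[hn mn _]]].
  apply: (grows_cons GF).
    by rewrite /= e1 card_seqI /= ?inE ?negb_or ?cd ?ch ?dh // addn0 addnA s2.
  apply: (grows_cons G'F) => //; rewrite /= e2 card_seqI /= ?inE ?negb_or ?cm ?cn ?mn //.
  rewrite !eG !inE eqxx orbT (eq_sym m c) (eq_sym m d) (eq_sym m h).
  rewrite (eq_sym n c) (eq_sym n d) (eq_sym n h) (negbTE cm) (negbTE dm) (negbTE hm).
  by rewrite (negbTE cn) (negbTE dn) (negbTE hn) !orbF addn0 s1.
have six : (u \in f) + (v \in f) + (a \in f) + (y \in f) + (z \in f) + (r \in f) = 3.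
  by rewrite -(unifF f fF) -(setIidPr fU) card_seqI //= !in_setI; rewrite !addnA addn0 !inE !eqxx ?orbT.
have nline c d h : [set w in [:: c; d; h]] \in lines -> uniq [:: c; d; h] ->
    ~~ [&& c \in f, d \in f & h \in f].
  move=> Ll unc; apply: contra fl => /and3P[cf df hf].
  suff <- : [set w in [:: c; d; h]] = f by [].
  apply/eqP; rewrite eqEcard unifF // cardsE (card_uniqP unc) /= andbT.
  by apply/subsetP => w; rewrite !inE => /or3P[]/eqP->.
have sub_uniq idx : all (fun i => i < 6) idx -> uniq idx ->
    uniq (map (nth u [:: u; v; a; y; z; r]) idx).
  move=> /allP h ui; rewrite map_inj_in_uniq // => i j /h li /h lj /eqP.
  by rewrite nth_uniq // => /eqP.
have n1 := nline u v a (mem_head _ _) (sub_uniq [:: 0; 1; 2] isT isT).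
have n2 : ~~ [&& a \in f, y \in f & z \in f].
  by apply: nline; [rewrite !inE eqxx ?orbT | exact: (sub_uniq [:: 2; 3; 4])].
have n3 : ~~ [&& u \in f, y \in f & r \in f].
  by apply: nline; [rewrite !inE eqxx ?orbT | exact: (sub_uniq [:: 0; 3; 5])].
have n4 : ~~ [&& v \in f, z \in f & r \in f].
  by apply: nline; [rewrite !inE eqxx ?orbT | exact: (sub_uniq [:: 1; 4; 5])].
(* The twelve entries are the ordered pairs of lines, the common point listed first. Inspection of
   all subsets of the six points shows that one of them fits [f]. *)
have : has id [::
  ((a \in f) + (u \in f) + (v \in f) == 2) && ((y \in f) + (z \in f) == 1);
  ((u \in f) + (v \in f) + (a \in f) == 2) && ((y \in f) + (r \in f) == 1);
  ((v \in f) + (u \in f) + (a \in f) == 2) && ((z \in f) + (r \in f) == 1);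
  ((a \in f) + (y \in f) + (z \in f) == 2) && ((u \in f) + (v \in f) == 1);
  ((y \in f) + (a \in f) + (z \in f) == 2) && ((u \in f) + (r \in f) == 1);
  ((z \in f) + (a \in f) + (y \in f) == 2) && ((v \in f) + (r \in f) == 1);
  ((u \in f) + (y \in f) + (r \in f) == 2) && ((v \in f) + (a \in f) == 1);
  ((y \in f) + (u \in f) + (r \in f) == 2) && ((a \in f) + (z \in f) == 1);
  ((r \in f) + (u \in f) + (y \in f) == 2) && ((v \in f) + (z \in f) == 1);
  ((v \in f) + (z \in f) + (r \in f) == 2) && ((u \in f) + (a \in f) == 1);
  ((z \in f) + (v \in f) + (r \in f) == 2) && ((a \in f) + (y \in f) == 1);
  ((r \in f) + (v \in f) + (z \in f) == 2) && ((u \in f) + (y \in f) == 1)].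
  move: six n1 n2 n3 n4; do 6!case: (_ \in f) => //=.
rewrite [has _ _]/= orbF; case/orP=> [/andP[/eqP s2 /eqP s1]|].
  by apply: (step a u v y z [set w in [:: u; v; a]] [set w in [:: a; y; z]]);
    [exact: (sub_uniq [:: 2; 0; 1; 3; 4])
    | move=> w; rewrite !inE; do !case: (w == _) => //
    | move=> w; rewrite !inE; do !case: (w == _) => // | ..].
case/orP=> [/andP[/eqP s2 /eqP s1]|].
  by apply: (step u v a y r [set w in [:: u; v; a]] [set w in [:: u; y; r]]);
    [exact: (sub_uniq [:: 0; 1; 2; 3; 5])
    | move=> w; rewrite !inE; do !case: (w == _) => //
    | move=> w; rewrite !inE; do !case: (w == _) => // | ..].
case/orP=> [/andP[/eqP s2 /eqP s1]|].
  by apply: (step v u a z r [set w in [:: u; v; a]] [set w in [:: v; z; r]]);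
    [exact: (sub_uniq [:: 1; 0; 2; 4; 5])
    | move=> w; rewrite !inE; do !case: (w == _) => //
    | move=> w; rewrite !inE; do !case: (w == _) => // | ..].
case/orP=> [/andP[/eqP s2 /eqP s1]|].
  by apply: (step a y z u v [set w in [:: a; y; z]] [set w in [:: u; v; a]]);
    [exact: (sub_uniq [:: 2; 3; 4; 0; 1])
    | move=> w; rewrite !inE; do !case: (w == _) => //
    | move=> w; rewrite !inE; do !case: (w == _) => // | ..].
case/orP=> [/andP[/eqP s2 /eqP s1]|].
  by apply: (step y a z u r [set w in [:: a; y; z]] [set w in [:: u; y; r]]);
    [exact: (sub_uniq [:: 3; 2; 4; 0; 5])
    | move=> w; rewrite !inE; do !case: (w == _) => //
    | move=> w; rewrite !inE; do !case: (w == _) => // | ..].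
case/orP=> [/andP[/eqP s2 /eqP s1]|].
  by apply: (step z a y v r [set w in [:: a; y; z]] [set w in [:: v; z; r]]);
    [exact: (sub_uniq [:: 4; 2; 3; 1; 5])
    | move=> w; rewrite !inE; do !case: (w == _) => //
    | move=> w; rewrite !inE; do !case: (w == _) => // | ..].
case/orP=> [/andP[/eqP s2 /eqP s1]|].
  by apply: (step u y r v a [set w in [:: u; y; r]] [set w in [:: u; v; a]]);
    [exact: (sub_uniq [:: 0; 3; 5; 1; 2])
    | move=> w; rewrite !inE; do !case: (w == _) => //
    | move=> w; rewrite !inE; do !case: (w == _) => // | ..].
case/orP=> [/andP[/eqP s2 /eqP s1]|].
  by apply: (step y u r a z [set w in [:: u; y; r]] [set w in [:: a; y; z]]);
    [exact: (sub_uniq [:: 3; 0; 5; 2; 4])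
    | move=> w; rewrite !inE; do !case: (w == _) => //
    | move=> w; rewrite !inE; do !case: (w == _) => // | ..].
case/orP=> [/andP[/eqP s2 /eqP s1]|].
  by apply: (step r u y v z [set w in [:: u; y; r]] [set w in [:: v; z; r]]);
    [exact: (sub_uniq [:: 5; 0; 3; 1; 4])
    | move=> w; rewrite !inE; do !case: (w == _) => //
    | move=> w; rewrite !inE; do !case: (w == _) => // | ..].
case/orP=> [/andP[/eqP s2 /eqP s1]|].
  by apply: (step v z r u a [set w in [:: v; z; r]] [set w in [:: u; v; a]]);
    [exact: (sub_uniq [:: 1; 4; 5; 0; 2])
    | move=> w; rewrite !inE; do !case: (w == _) => //
    | move=> w; rewrite !inE; do !case: (w == _) => // | ..].
case/orP=> [/andP[/eqP s2 /eqP s1]|].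
  by apply: (step z v r a y [set w in [:: v; z; r]] [set w in [:: a; y; z]]);
    [exact: (sub_uniq [:: 4; 1; 5; 2; 3])
    | move=> w; rewrite !inE; do !case: (w == _) => //
    | move=> w; rewrite !inE; do !case: (w == _) => // | ..].
case/andP=> /eqP s2 /eqP s1.
  by apply: (step r v z u y [set w in [:: v; z; r]] [set w in [:: u; y; r]]);
    [exact: (sub_uniq [:: 5; 1; 4; 0; 3])
    | move=> w; rewrite !inE; do !case: (w == _) => //
    | move=> w; rewrite !inE; do !case: (w == _) => // | ..].
Qed.

Lemma set_of3 (A : {set V}) c d h : #|A| = 3 -> uniq [:: c; d; h] ->
  c \in A -> d \in A -> h \in A -> A = [set w in [:: c; d; h]].
Proof.
move=> cA un cc dd hh; apply/eqP; rewrite eq_sym eqEcard cA cardsE (card_uniqP un) andbT.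
by apply/subsetP => w; rewrite !inE => /or3P[]/eqP->.
Qed.

(** Since [x >= 3], the end edge [e1] of a maximal path has two vertices [u], [v] outside the second
    edge. Both yield closing edges, [fu] and [fv], of the same closed cycle, and all vertices of
    [fv] except [v] and [z] lie in [fu]. If [fu] and [fv] share two vertices, then [fu], [fv], [e1]
    is the structure. Otherwise [x = 3], and the two closing edges with the path form either a
    structure or a Pasch configuration. *)
Theorem critical_dense F x : 2 < x -> (forall g, g \in F -> #|g| = x) ->
  critical F -> dense_in F x.
Proof.
move=> x3 unifF cF.
have meetF e v : e \in F -> v \in e -> exists2 f, f \in F & f :&: e = [set v].
  by apply: critical_meet => // g /unifF->; apply: ltnW.
have F0 : F != set0.
  apply/eqP => F0; case: cF => /existsP[]; exists set0.
  by apply/forall_inP => e; rewrite F0 inE.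
have [p [lp pn nl]] := loose_max x3 unifF F0.
case: p => [//|e1 rest] in lp pn nl *; clear pn.
have e1F : e1 \in F by case/andP: lp.
have rn : rest != [::].
  apply: contraTneq lp => rn; apply/negP => _.
  have /card_gt0P[v ve1] : 0 < #|e1| by rewrite unifF //; apply: ltn_trans x3.
  have [f fF fe] := meetF e1 v e1F ve1.
  by have /negP[] := nl f; rewrite rn /= fF e1F fe cards1.
have [u [v [uv ue1 ve1 uh vh]]] : exists u v, [/\ u != v, u \in e1, v \in e1,
    u \notin head set0 rest & v \notin head set0 rest].
  have : 1 < #|e1 :\: head set0 rest|.
    have := cardsID (head set0 rest) e1; rewrite (unifF e1 e1F).
    have -> : #|e1 :&: head set0 rest| = 1.
      by case: rest lp rn {nl} => //= e2 r /and3P[_ _ /andP[/eqP->]].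
    by move: x3; clear; lia.
  case/card_gt1P=> u [v []]; rewrite !inE => /andP[? ?] /andP[? ?] ?.
  by exists u, v.
have [fu fuF fue] := meetF e1 u e1F ue1.
have [fv fvF fve] := meetF e1 v e1F ve1.
have [//|[p1 [ei [y [er alu fuei uei clu]]]]] :=
  cycle_or_dense x3 unifF meetF lp ue1 uh fuF fue (nl fu).
have [//|[p1' [ei' [z [er' alv fvei vei _]]]]] :=
  cycle_or_dense x3 unifF meetF lp ve1 vh fvF fve (nl fv).
have [ep ee] : p1 = p1' /\ ei = ei' by move: er'; rewrite er => /rcons_inj[].
rewrite -ep -ee in alv fvei vei; clear er' ep ee p1' ei'.
have eiF : ei \in F by apply: (loose_sub lp); rewrite er inE mem_rcons inE eqxx orbT.
have [ufu _ fue1] := setI_eq1 fue; have [vfv _ fve1] := setI_eq1 fve.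
have [yfu yei fuei1] := setI_eq1 fuei; have [zfv zei fvei1] := setI_eq1 fvei.
have vfu : v \notin fu by apply: contraNN uv => /fue1/(_ ve1)->.
have ufv : u \notin fv by apply: contraNN uv => /fve1/(_ ue1)->.
have fvU : fv \subset fu :|: e1 :|: cov p1 :|: ei.
  by apply: clu => //; apply/set0Pn; exists v; rewrite !inE vfv ve1 !orbT.
have fvR : (fv :\ v) :\ z \subset fu :&: fv.
  apply/subsetP => w; rewrite !inE => /and3P[wz wv wfv]; rewrite wfv andbT.
  have := subsetP fvU w wfv; rewrite in_setU in_setU in_setU -!orbA => /or4P[//|h|/covP[g gp wg]|h].
  - by move: wv; rewrite (fve1 w wfv h) eqxx.
  - by case: (disjoint_meetF (allP alv g gp) wfv wg).
  - by move: wz; rewrite (fvei1 w wfv h) eqxx.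
have vz : v != z by apply: contraNneq vei => ->.
have uy : u != y by apply: contraNneq uei => ->.
have cR : x - 2 <= #|(fv :\ v) :\ z|.
  have := unifF fv fvF; rewrite (cardsD1 v) vfv (cardsD1 z) !inE zfv eq_sym vz /=.
  by move: #|_| => n <-; clear; lia.
have e1fufv : #|e1 :&: (fu :|: fv)| = 2.
  by rewrite setIUr [e1 :&: fu]setIC fue [e1 :&: fv]setIC fve cards2 uv.
have cx : #|fv :&: fu| < x.
  rewrite -(unifF fv fvF); apply: proper_card; rewrite properE subsetIl /=.
  by apply/subsetPn; exists v; rewrite // inE negb_and vfu orbT.
have [w2|w1] := ltnP 1 #|fv :&: fu|.
  apply: (@dense_inI _ _ 0 #|fv :&: fu| false 0 2 fu); rewrite ?w2 ?orbT //.
  apply: (grows_cons fvF); first by apply: attaches_jump => //; apply: ltnW.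
  by apply: (grows_cons e1F) => //; apply: attaches_jump.
have /eqP x3' : x == 3.
  have := leq_trans cR (subset_leq_card fvR); rewrite setIC => h.
  by move: (leq_trans h w1) x3; clear; lia.
have zfu : z \notin fu.
  apply/negP => zfu; have : z |: (fv :\ v) :\ z \subset fv :&: fu.
    by rewrite subUset sub1set inE zfv zfu setIC.
  move/subset_leq_card; rewrite cardsU1 !inE eqxx /= => h.
  by move: (leq_trans h w1) cR; rewrite x3'; clear; move: #|_| => n; lia.
have /card_gt0P[r rR] : 0 < #|(fv :\ v) :\ z| by move: cR; rewrite x3'; apply: leq_trans.
have := subsetP fvR r rR; rewrite inE => /andP[rfu rfv].
move: rR; rewrite !inE => /and3P[rz rv _].
have fvfu : #|fv :&: fu| = 1.
  by apply/eqP; rewrite eqn_leq w1 card_gt0; apply/set0Pn; exists r; rewrite inE rfu rfv.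
have yfv : y \notin fv.
  apply: contraNN zfu => yfv; suff <- : y = z by [].
  exact: fvei1.
have yz : y != z by apply: contraNneq zfu => <-.
have fvatt : attaches 0 fu fu fv by rewrite /= fvfu subsetIr.
have [ei_cov cei_cov dei] : [/\ ei :&: cov (e1 :: p1) = ei :&: last e1 p1,
    #|ei :&: cov (e1 :: p1)| = 1
    & all (fun h : {set V} => [disjoint ei & h]) (belast e1 p1)].
  by apply: (@loose_cov F _ _ _ [::]); rewrite cats1 -er.
have eifufv : ei :&: (fu :|: fv) = [set y; z].
  by rewrite setIUr [ei :&: fu]setIC fuei [ei :&: fv]setIC fvei.
(* When [p1] is nonempty, [ei] is disjoint from [e1] and attaches to [fu], [fv], [e1] in [y] and [z]
   only. When it is empty, [ei] also contains a point of [e1] and is covered: this is the Pasch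
   case. *)
case: p1 => [|g p1] in er alu alv clu fvU ei_cov cei_cov dei *; last first.
  apply: (@dense_inI _ _ 1 2 false 0 2 fu) => //; first by rewrite expn_gt0.
  apply: (grows_cons fvF fvatt); apply: (grows_cons e1F); first exact: attaches_jump.
  apply: (grows_cons eiF) => //; apply: attaches_jump => //.
  rewrite setIUr eifufv (disjoint_setI0 (allP dei e1 _)) ?inE ?eqxx //.
  by rewrite setU0 cards2 yz.
have /cards1P[a ea] : #|ei :&: e1| == 1 by move: cei_cov; rewrite ei_cov /= => ->.
have [aei ae1 _] := setI_eq1 ea.
have ua : u != a by apply: contraNneq uei => ->.
have va : v != a by apply: contraNneq vei => ->.
have afu : a \notin fu by apply: contraNN ua => h; rewrite (fue1 a h ae1).
have afv : a \notin fv by apply: contraNN va => h; rewrite (fve1 a h ae1).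
have ay : a != y by apply: contraNneq afu => ->.
have az : a != z by apply: contraNneq afv => ->.
have uz : u != z by apply: contraNneq ufv => ->.
have vy : v != y by apply: contraNneq vfu => ->.
have ur : u != r by apply: contraNneq ufv => ->.
have vr : v != r by rewrite eq_sym.
have ar : a != r by apply: contraNneq afu => ->.
have yr : y != r by apply: contraNneq yfv => ->.
have zr : z != r by rewrite eq_sym.
have un : uniq [:: u; v; a; y; z; r].
  by rewrite /= !inE !negb_or uv ua uy uz ur va vy vz vr ay az ar yz yr zr.
rewrite x3' in unifF *.
have E1 : e1 = [set w in [:: u; v; a]].
  by apply: set_of3; rewrite ?unifF //= !inE !negb_or uv ua va.
have E2 : ei = [set w in [:: a; y; z]].
  by apply: set_of3; rewrite ?unifF //= !inE !negb_or ay az yz.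
have E3 : fu = [set w in [:: u; y; r]].
  by apply: set_of3; rewrite ?unifF //= !inE !negb_or uy ur yr.
have E4 : fv = [set w in [:: v; z; r]].
  by apply: set_of3; rewrite ?unifF //= !inE !negb_or vz vr zr.
apply: (pasch_dense cF unifF un); rewrite -?E1 -?E2 -?E3 -?E4 //.
have <- // : fu :|: e1 :|: cov [::] :|: ei = [set w in [:: u; v; a; y; z; r]].
apply/setP => w; rewrite E1 E2 E3 !inE /= orbF.
by do !case: (w == _) => //.
Qed.
End TwoColouring.

Import Order.TTheory GRing.Theory Num.Theory.
Local Open Scope ring_scope.

(** * Random subsets *)

Section RandomSubset.
Variables (R : realFieldType) (V : finType) (q : R).
Hypothesis q01 : 0 <= q <= 1.
Implicit Types (S T U Z A l g : {set V}).

Definition keep_weight S : R := q ^+ #|S| * (1 - q) ^+ #|~: S|.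

Lemma keep_weight_ge0 S : 0 <= keep_weight S.
Proof. by case/andP: q01 => *; rewrite mulr_ge0 ?exprn_ge0 ?subr_ge0. Qed.

(** Expanding the product of [a v + b v], with [a] zero on [Z] and [b] zero on [T], keeps exactly
    the weights of the wanted sets. *)
Lemma sum_keep_between T Z :
  \sum_(S : {set V} | (T \subset S) && [disjoint S & Z]) keep_weight S
  <= q ^+ #|T| * (1 - q) ^+ #|Z|.
Proof.
case/andP: q01 => q0 q1.
have [dTZ|nTZ] := boolP [disjoint T & Z]; last first.
  rewrite big1 ?mulr_ge0 ?exprn_ge0 ?subr_ge0 // => S /andP[TS SZ].
  by case/negP: nTZ; apply: disjointWl SZ.
pose a v : R := if v \in Z then 0 else q.
pose b v : R := if v \in T then 0 else 1 - q.
have eP : \prod_i (a i + b i) =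
    \sum_(J in {set V}) \prod_i (if i \in J then a i else b i) by exact: bigA_distr.
rewrite (_ : \sum_(S | _) _ = \sum_(J in {set V}) \prod_i (if i \in J then a i else b i)).
  rewrite -eP (bigID (mem T)) /=.
  rewrite (eq_bigr (fun=> q)) => [|v vT]; last first.
    rewrite /a /b vT addr0 ifF //; apply/negbTE/negP => vZ.
    by case: (disjoint_meetF dTZ vT vZ).
  rewrite prodr_const ler_wpM2l ?exprn_ge0 //.
  rewrite (bigID (mem Z)) /= (eq_bigr (fun=> 1 - q)); last first.
    by move=> v /andP[vT vZ]; rewrite /a /b vZ (negbTE vT) add0r.
  rewrite [X in _ * X]big1 ?mulr1; last first.
    by move=> v /andP[vT vZ]; rewrite /a /b (negbTE vZ) (negbTE vT) addrC subrK.
  rewrite prodr_const (eq_card (B := mem Z)) // => v.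
  rewrite unfold_in /= andbC; case vZ: (v \in Z) => //=; apply/negP => vT.
  by case: (disjoint_meetF dTZ vT vZ).
rewrite [RHS](bigID (fun S : {set V} => (T \subset S) && [disjoint S & Z])) /=.
rewrite [X in _ = _ + X]big1 ?addr0.
  apply: eq_big => // S /andP[TS SZ]; rewrite (bigID (mem S)) /=.
  rewrite (eq_bigr (fun=> q)) ?prodr_const => [|v vS]; last first.
    rewrite vS /a ifF //; apply/negbTE/negP => vZ.
    by case: (disjoint_meetF SZ vS vZ).
  rewrite [X in _ = _ * X](eq_bigr (fun=> 1 - q)) ?prodr_const => [|v vS]; last first.
    by rewrite (negbTE vS) /b ifF //; apply: contraNF vS => /(subsetP TS).
  by congr (_ * _ ^+ _); apply: eq_card => v; rewrite !inE.
move=> S; rewrite negb_and => /orP[/subsetPn[v vT vS]|].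
  by rewrite (bigD1 v) //= (negbTE vS) /b vT mul0r.
rewrite -setI_eq0 => /set0Pn[v]; rewrite inE => /andP[vS vZ].
by rewrite (bigD1 v) //= vS /a vZ mul0r.
Qed.

Lemma sum_keep_above T :
  \sum_(S : {set V} | T \subset S) keep_weight S <= q ^+ #|T|.
Proof.
have := sum_keep_between T set0; rewrite cards0 expr0 mulr1; apply: le_trans.
rewrite le_eqVlt; apply/orP; left; apply/eqP; apply: eq_bigl => S.
by rewrite -setI_eq0 setI0 eqxx andbT.
Qed.

Lemma sum_union_bound (I J : finType) (f : I -> R) (P : pred I) (K : pred J)
    (Q : J -> pred I) : (forall i, 0 <= f i) ->
  (forall i, P i -> exists2 j, K j & Q j i) ->
  \sum_(i | P i) f i <= \sum_(j | K j) \sum_(i | Q j i) f i.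
Proof.
move=> f0 PQ; rewrite (exchange_big_dep predT) //= [leRHS](bigID P) /= ler_wpDr //.
  by apply: sumr_ge0 => i _; apply: sumr_ge0.
apply: ler_sum => i /PQ[j Kj Qj]; rewrite (bigD1 j) ?Kj //= ler_wpDr //.
exact: sumr_ge0.
Qed.

(** * Expected number of growing structures *)

Variable F : {set {set V}}.

Definition inside S : {set {set V}} := [set g in F | g \subset S].

(** The expected number of ways to grow along [w] once [U] is kept: attaching [g] costs one factor
    [q] for each new vertex. *)
Fixpoint grow_sum (w : seq nat) U l : R :=
  if w is a :: w' then
    \sum_(g in F | attaches a U l g) q ^+ #|g :\: U| * grow_sum w' (U :|: g) g
  else 1.

Lemma sum_keep_grows w U l :
  \sum_(S : {set V} | (U \subset S) && grows (inside S) w U l) keep_weight S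
  <= q ^+ #|U| * grow_sum w U l.
Proof.
elim: w U l => [|a w IH] U l.
  rewrite mulr1; apply: le_trans (sum_keep_above U).
  by under eq_bigl do rewrite andbT.
rewrite /= mulr_sumr.
apply: le_trans (sum_union_bound (K := fun g => (g \in F) && attaches a U l g)
  (Q := fun g S => (U :|: g \subset S) && grows (inside S) w (U :|: g) g) _ _) _.
- exact: keep_weight_ge0.
- move=> S /andP[US /grows_consP[g [gS ag gr]]]; move: gS; rewrite inE => /andP[gF gS].
  by exists g; rewrite ?gF // subUset US gS.
apply: ler_sum => g _; apply: le_trans (IH _ _) _.
rewrite mulrA -exprD.
have -> // : #|U :|: g| = (#|U| + #|g :\: U|)%N.
by rewrite cardsU cardsD setIC addnBA // subset_leq_card // subsetIl.
Qed.

Lemma bin_leq_exp n a : ('C(n, a) <= n ^ a)%N.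
Proof.
elim: n a => [|n IH] [|a] //.
rewrite binS; apply: leq_trans (leq_add (IH _) (IH _)) _.
rewrite expnS addnC -mulSn expnS leq_mul2l /=.
by case: a => // a; rewrite leq_exp2r.
Qed.

Variables (x : nat) (D : nat -> R).
Hypotheses (unifF : forall g, g \in F -> #|g| = x).
Hypothesis degF : forall A, (0 < #|A| < x)%N ->
  #|[set g in F | A \subset g]|%:R <= D #|A|.

Definition growth a : R := D a * q ^+ (x - a).

(** A step [0] attaches at one of the [x] vertices of the last edge, whatever the size of the
    structure; any other step chooses its [a] vertices among at most [m] visited ones. *)
Definition growth_factor (m a : nat) : R :=
  if a is 0 then x%:R * growth 1 else (m ^ a)%:R * growth a.

Lemma sum_attached (U : {set V}) a (P : pred {set V}) (G : {set V} -> R) (B : R) :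
  (0 < a < x)%N -> 0 <= B -> (forall g, g \in F -> G g <= B) ->
  \sum_(g in F | (#|g :&: U| == a) && P (g :&: U)) q ^+ #|g :\: U| * G g
  <= #|[set A : {set V} | [&& A \subset U, #|A| == a & P A]]|%:R * growth a * B.
Proof.
case/andP: q01 => q0 q1 ha B0 GB.
rewrite (partition_big (fun g => g :&: U) (mem [set A : {set V} | [&& A \subset U, #|A| == a & P A]])) /=; last first.
  by move=> g /and3P[_ c Pg]; rewrite inE subsetIr c Pg.
rewrite -mulrA -sum1_card natr_sum mulr_suml; apply: ler_sum => A.
rewrite inE => /and3P[AU /eqP cA PA]; rewrite mul1r.
have haA : (0 < #|A| < x)%N by rewrite cA.
apply: (@le_trans _ _ (\sum_(g in [set g in F | A \subset g]) q ^+ (x - a) * B)); last first.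
  rewrite sumr_const -[leLHS]mulr_natl mulrA /growth -cA.
  rewrite ler_wpM2r // ler_wpM2r ?exprn_ge0 //.
  exact: degF.
rewrite [leRHS](bigID (fun g => (#|g :&: U| == a) && P (g :&: U) && (g :&: U == A))) /=.
rewrite ler_wpDr //; first by apply: sumr_ge0 => g _; rewrite mulr_ge0 ?exprn_ge0.
rewrite [leRHS](eq_bigl (fun g => (g \in F) && ((#|g :&: U| == a) && P (g :&: U)) && (g :&: U == A))).
  apply: ler_sum => g /andP[/and3P[gF /eqP cg _] _].
  by rewrite cardsD unifF // cg ler_wpM2l ?exprn_ge0 ?GB.
move=> g; rewrite inE; case: (g \in F) => //=.
case: (g :&: U =P A) => [gA|]; last by rewrite !andbF.
by rewrite -gA subsetIl.
Qed.

Lemma grow_sum_le w U l m : all (fun a => a < x)%N w -> (1 < x)%N ->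
  (forall a, (0 < a < x)%N -> 0 <= growth a) ->
  (#|U| + x * size w <= m)%N -> (#|l| <= x)%N ->
  grow_sum w U l <= \prod_(a <- w) growth_factor m a.
Proof.
move=> + x1 g0; elim: w U l => [|a w IH] U l /=; first by rewrite big_nil.
case/andP=> ax aw hm hl; rewrite big_cons.
have gf0 b : (b < x)%N -> 0 <= growth_factor m b.
  by case: b => [|b] bx; rewrite mulr_ge0 // g0.
have B0 : 0 <= \prod_(a <- w) growth_factor m a.
  by rewrite big_seq; apply: prodr_ge0 => b /(allP aw)/gf0.
have GB g : g \in F -> grow_sum w (U :|: g) g <= \prod_(a <- w) growth_factor m a.
  move=> gF; apply: IH => //; last by rewrite (unifF gF).
  apply: leq_trans hm; rewrite mulnS addnA leq_add2r.
  by apply: leq_trans (leq_card_setU _ _) _; rewrite (unifF gF).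
case: a ax => [|a] ax /=.
  apply: le_trans (@sum_attached U 1 (fun A => A \subset l) _ _ x1 B0 GB) _.
  rewrite ler_wpM2r // ler_wpM2r ?g0 // ler_nat.
  apply: leq_trans hl; rewrite -[#|l|]bin1 -cards_draws; apply: subset_leq_card.
  by apply/subsetP => A; rewrite !inE => /and3P[_ -> ->].
have -> : \sum_(g in F | #|g :&: U| == a.+1) q ^+ #|g :\: U| * grow_sum w (U :|: g) g =
    \sum_(g in F | (#|g :&: U| == a.+1) && true) q ^+ #|g :\: U| * grow_sum w (U :|: g) g.
  by apply: eq_bigl => g; rewrite andbT.
apply: le_trans (@sum_attached U a.+1 xpredT _ _ ax B0 GB) _.
rewrite ler_wpM2r // ler_wpM2r ?g0 // ler_nat.
apply: (@leq_trans 'C(#|U|, a.+1)).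
  rewrite -cards_draws; apply: subset_leq_card.
  by apply/subsetP => A; rewrite !inE => /and3P[-> -> _].
apply: leq_trans (bin_leq_exp _ _) _; rewrite leq_exp2r //.
by apply: leq_trans hm; rewrite leq_addr.
Qed.

Lemma sum_keep_word w : all (fun a => a < x)%N w -> (1 < x)%N ->
  (forall a, (0 < a < x)%N -> 0 <= growth a) ->
  \sum_(S : {set V} | [exists g in inside S, grows (inside S) w g g]) keep_weight S
  <= #|F|%:R * q ^+ x * \prod_(a <- w) growth_factor (x * (size w).+1) a.
Proof.
case/andP: (q01) => q0 q1 aw x1 g0.
apply: le_trans (sum_union_bound (K := mem F)
  (Q := fun g S => (g \subset S) && grows (inside S) w g g) keep_weight_ge0 _) _.
  move=> S /exists_inP[g]; rewrite inE => /andP[gF gS] gr.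
  by exists g => //; rewrite gS.
rewrite -mulrA mulr_natl -sumr_const; apply: ler_sum => g gF.
apply: le_trans (sum_keep_grows w g g) _.
rewrite unifF // ler_wpM2l ?exprn_ge0 //.
by apply: grow_sum_le => //; rewrite unifF // -mulnS.
Qed.

Lemma sum_half_le n : \sum_(i < n) (2^-1 : R) ^+ i <= 2.
Proof.
suff -> : \sum_(i < n) (2^-1 : R) ^+ i = 2 - 2 * 2^-1 ^+ n.
  by rewrite lerBlDr lerDl mulr_ge0 ?exprn_ge0 ?invr_ge0.
elim: n => [|n IH]; first by rewrite big_ord0 expr0 mulr1 subrr.
by rewrite big_ord_recr /= IH exprS; field.
Qed.

(** The number of visited vertices is at most [m <= 4x * 2 ^ (n1 + n2)], so the free choices, at
    most [m ^ (2 * x).+1] in number, cost a constant and a factor [2 ^ (2 * x).+1] for each path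
    step. The hypothesis on [growth 1] leaves [1/2] for each path step; [growth 1 <= 1] takes care
    of the optional step. *)
Lemma sum_keep_spread n1 a (eps : bool) n2 b (delta : R) : (1 < x)%N ->
  (0 < a < x)%N -> (0 < b < x)%N ->
  (forall a, (0 < a < x)%N -> 0 <= growth a) -> growth 1 <= 1 ->
  x%:R * growth 1 * 2 ^+ (2 * x).+1 <= 2^-1 ->
  0 <= delta -> #|F|%:R * q ^+ x * growth a * growth b <= delta ->
  \sum_(S : {set V} | [exists g in inside S,
     grows (inside S) (spread n1 a eps n2 b) g g]) keep_weight S
  <= ((4 * x) ^ (2 * x).+1)%:R * delta * (2^-1 ^+ n1 * 2^-1 ^+ n2).
Proof.
case/andP: (q01) => q0 q1 x1 ha hb g0 g1 theta d0 hd.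
apply: le_trans (sum_keep_word _ x1 g0) _.
  rewrite /spread all_cat /= all_cat all_cat /= !all_nseq.
  by move: ha hb => /andP[_ ->] /andP[_ ->]; rewrite x1 (ltnW x1) !orbT.
set m := (x * _)%N.
have m0 : (0 < m)%N by rewrite muln_gt0 (ltnW x1).
rewrite /spread big_cat big_cons big_cat big_cat big_cons big_nil /= !big_nseq.
have gf a' : (0 < a')%N -> growth_factor m a' = (m ^ a')%:R * growth a' by case: a'.
case/andP: (ha) => a0 _; case/andP: (hb) => b0 _.
rewrite !iter_mulr_1 mulr1 (gf a a0) (gf b b0) (gf 1%N) //.
set th := growth_factor m 0.
have th0 : 0 <= th by rewrite mulr_ge0 ?g0.
have eE : (((m ^ 1)%:R * growth 1) ^+ eps : R) <= (m ^ eps)%:R.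
  by case: (eps) => //=; rewrite expr1 -[leRHS]mulr1; apply: ler_wpM2l.
have e0 : 0 <= ((m ^ 1)%:R * growth 1) ^+ eps :> R.
  by rewrite exprn_ge0 // mulr_ge0 ?g0.
have hM : ((m ^ a) * (m ^ eps) * (m ^ b) <= (4 * x) ^ (2 * x).+1 * (2 ^ (2 * x).+1) ^ (n1 + n2))%N.
  rewrite -!expnD; apply: (@leq_trans (m ^ (2 * x).+1)).
    rewrite leq_pexp2l //; move: ha hb => /andP[_ ha] /andP[_ hb].
    by rewrite mul2n -addnn; case: (eps) => /=; lia.
  rewrite -expnM [((2 * x).+1 * _)%N]mulnC expnM -expnMn leq_exp2r //.
  rewrite /m /spread !size_cat /= !size_cat !size_nseq /= [(4 * x)%N]mulnC -mulnA leq_mul2l.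
  apply/orP; right; apply: (@leq_trans (4 + (n1 + n2))); first by case: (eps) => /=; lia.
  have : (n1 + n2 < 2 ^ (n1 + n2))%N by apply: ltn_expl.
  by move: (n1 + n2)%N => c; move: (2 ^ c)%N => A; clear; lia.
have hth : th ^+ (n1 + n2) * ((2 ^ (2 * x).+1) ^ (n1 + n2))%:R <= 2^-1 ^+ n1 * 2^-1 ^+ n2.
  have c0 : 0 <= th * (2 ^ (2 * x).+1)%:R by exact: mulr_ge0.
  by rewrite -exprD natrX -exprMn lerXn2r ?nnegrE ?invr_ge0 ?c0 // natrX.
apply: (@le_trans _ _ (delta * (m ^ a * m ^ eps * m ^ b)%:R * th ^+ (n1 + n2))); last first.
  rewrite -mulrA [leRHS]mulrAC [leRHS]mulrC ler_wpM2l //.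
  apply: (@le_trans _ _ (((4 * x) ^ (2 * x).+1 * (2 ^ (2 * x).+1) ^ (n1 + n2))%:R * th ^+ (n1 + n2))).
    by rewrite ler_wpM2r ?exprn_ge0 // ler_nat.
  by rewrite natrM -mulrA ler_wpM2l // mulrC.
rewrite exprD (natrM _ (m ^ a * m ^ eps)%N) (natrM _ (m ^ a)%N).
have ga := g0 a ha; have gb := g0 b hb.
set u := (m ^ a)%:R; set v := (m ^ b)%:R; set w := (m ^ eps)%:R in eE *.
have u0 : 0 <= u by []. have v0 : 0 <= v by []. have w0 : 0 <= w by [].
set E := _ ^+ eps in eE e0 *.
have -> : #|F|%:R * q ^+ x * (th ^+ n1 * (u * growth a * (E * (th ^+ n2 * (v * growth b))))) =
  (#|F|%:R * q ^+ x * growth a * growth b) * (u * E * v) * (th ^+ n1 * th ^+ n2) by ring.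
have M0 : 0 <= #|F|%:R * q ^+ x by rewrite mulr_ge0 ?exprn_ge0.
apply: ler_wpM2r; first by apply: mulr_ge0; apply: exprn_ge0.
apply: ler_pM => //; first exact: mulr_ge0 (mulr_ge0 M0 ga) gb.
  exact: mulr_ge0 (mulr_ge0 u0 e0) v0.
by apply: ler_wpM2r => //; apply: ler_wpM2l.
Qed.

Theorem sum_keep_noncolourable (delta : R) : (2 < x)%N ->
  (forall a, (0 < a < x)%N -> 0 <= growth a) -> growth 1 <= 1 ->
  x%:R * growth 1 * 2 ^+ (2 * x).+1 <= 2^-1 -> 0 <= delta ->
  (forall a b, (2 <= a < x)%N -> (2 <= b < x)%N -> (a == 2) || (b == 2) ->
    #|F|%:R * q ^+ x * growth a * growth b <= delta) ->
  \sum_(S : {set V} | ~~ colourable (inside S)) keep_weight S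
  <= (8 * x ^ 2 * (4 * x) ^ (2 * x).+1)%:R * delta.
Proof.
move=> x3 g0 g1 theta d0 hd.
pose B := (2 ^ #|V|).+1.
pose K (j : ('I_B * 'I_B) * ('I_x * 'I_x * bool)) :=
  [&& 2 <= j.2.1.1, 2 <= j.2.1.2 & (j.2.1.1 == 2 :> nat) || (j.2.1.2 == 2 :> nat)]%N.
pose Q (j : ('I_B * 'I_B) * ('I_x * 'I_x * bool)) (S : {set V}) :=
  [exists g in inside S,
     grows (inside S) (spread j.1.1 j.2.1.1 j.2.2 j.1.2 j.2.1.2) g g].
apply: le_trans (sum_union_bound (K := K) (Q := Q) keep_weight_ge0 _) _.
  move=> S /critical_subset[F' sF' cF'].
  have uF' g : g \in F' -> #|g| = x.
    by move=> /(subsetP sF'); rewrite inE => /andP[/unifF].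
  have [n1 [a [eps [n2 [b [h1 h2 h3 h4 [g gF gr]]]]]]] := critical_dense x3 uF' cF'.
  move: h3 => /andP[/andP[a2 ax] /andP[b2 bx]].
  exists ((Ordinal (h1 : n1 < B)%N, Ordinal (h2 : n2 < B)%N),
          (Ordinal ax, Ordinal bx, eps)); first by rewrite /K /= a2 b2.
  apply/exists_inP; exists g; first exact: (subsetP sF').
  exact: growsS gr.
set C := ((4 * x) ^ (2 * x).+1)%:R * delta.
have C0 : 0 <= C by rewrite mulr_ge0.
apply: (@le_trans _ _ (\sum_(j | K j) C * (2^-1 ^+ j.1.1 * 2^-1 ^+ j.1.2))).
  apply: ler_sum => -[[n1 n2] [[a b] eps]] /and3P[/= a2 b2 ab].
  apply: sum_keep_spread => //; first exact: ltn_trans x3.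
  - by rewrite (leq_trans _ a2) /=.
  - by rewrite (leq_trans _ b2) /=.
  by apply: hd; rewrite ?a2 ?b2 /=.
apply: (@le_trans _ _ (\sum_(j : ('I_B * 'I_B) * ('I_x * 'I_x * bool)) C * (2^-1 ^+ j.1.1 * 2^-1 ^+ j.1.2))).
  rewrite [leRHS](bigID K) /= ler_wpDr // sumr_ge0 // => j _.
  by rewrite !mulr_ge0 ?exprn_ge0 ?invr_ge0.
rewrite -mulr_sumr -(pair_bigA _ (fun (i : 'I_B * 'I_B) (_ : 'I_x * 'I_x * bool) =>
  2^-1 ^+ i.1 * 2^-1 ^+ i.2 : R)) /=.
under eq_bigr do rewrite sumr_const !card_prod card_bool !card_ord.
rewrite -(pair_bigA _ (fun i j : 'I_B => (2^-1 ^+ i * 2^-1 ^+ j : R) *+ (x * x * 2))) /=.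
under eq_bigr do rewrite sumrMnl -mulr_sumr.
rewrite sumrMnl -mulr_suml.
have := ler_pM _ _ (sum_half_le B) (sum_half_le B).
have s0 : 0 <= \sum_(i < B) (2^-1 : R) ^+ i by apply: sumr_ge0 => i _; rewrite exprn_ge0 ?invr_ge0.
move=> /(_ s0 s0) h.
(* Each of the two geometric sums is at most 2, and there are [x * x * 2] choices of [a], [b],
   [eps]; hence the constant [8 * x ^ 2]. *)
apply: (@le_trans _ _ (C * ((2 * 2) *+ (x * x * 2)))).
  by rewrite ler_wpM2l // lerMn2r h orbT.
have -> : (2 * 2 : R) *+ (x * x * 2) = (8 * x ^ 2)%:R.
  by rewrite -mulr_natr -mulnn !natrM; ring.
by rewrite /C [in leRHS]natrM [leLHS]mulrC mulrA.
Qed.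
End RandomSubset.

(** * Containers *)

Section Queries.
Variable V : finType.
Implicit Types (I J c : {set V}).

(** The first component is a fingerprint. Consistency makes the answer on [I] equal to the answer on
    the fingerprint of [I], so that answers can be counted by small sets. *)
Definition alg (X : Type) := {set V} -> {set V} * X.

(* An algorithm reads its input [I] only through the elements of [I] that it
   records in its first output. *)
Definition consistent X (a : alg X) := forall I, (a I).1 \subset I /\
  forall J, (a I).1 \subset J -> J \subset I -> a J = a I.

Definition ret X (x : X) : alg X := fun=> (set0, x).

Definition bind X Y (a : alg X) (f : X -> alg Y) : alg Y := fun I =>
  ((a I).1 :|: (f (a I).2 I).1, (f (a I).2 I).2).

Definition query c : alg (option V) := fun I =>
  if [pick v in I :&: c] is Some v then ([set v], Some v) else (set0, None).

Lemma consistent_ret X (x : X) : consistent (ret x).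
Proof. by move=> I; rewrite sub0set. Qed.

Lemma consistent_bind X Y (a : alg X) (f : X -> alg Y) :
  consistent a -> (forall x, consistent (f x)) -> consistent (bind a f).
Proof.
move=> ca cf I; have [aI aJ] := ca I; have [fI fJ] := cf (a I).2 I.
rewrite subUset aI fI; split=> // J; rewrite subUset => /andP[h1 h2] JI.
by rewrite /bind aJ // fJ.
Qed.

Lemma pick_sub (P Q : pred V) v : (forall w, Q w -> P w) -> Q v ->
  [pick w | P w] = Some v -> [pick w | Q w] = Some v.
Proof.
move=> QP Qv; rewrite /pick /enum_mem.
elim: (Finite.enum V) => //= a s IH; rewrite /in_mem /=.
case Pa: (P a) => /=; first by case=> av; rewrite av Qv.
by have -> : Q a = false by apply: contraFF Pa => /QP.
Qed.

(** The pick returns the first element in the enumeration of [V], and the first element of [I :&: c]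
    remains first in [J :&: c] when [J] is a subset of [I] containing it. A failed query may record
    nothing because it fails on all subsets of [I]. *)
Lemma consistent_query c : consistent (query c).
Proof.
move=> I; rewrite /query; case E: [pick v in I :&: c] => [v|].
  have vI : v \in I :&: c by case: pickP E => // w wI [<-].
  move: (vI); rewrite inE sub1set => /andP[-> vc]; split=> // J; rewrite sub1set => vJ JI.
  rewrite (pick_sub _ _ E) ?inE ?vJ // => w; rewrite !inE => /andP[wJ ->].
  by rewrite (subsetP JI).
rewrite sub0set; split=> // J _ JI; case: pickP => // w; rewrite inE => /andP[wJ wc].
by case: pickP E => // /(_ w); rewrite inE (subsetP JI _ wJ) wc.
Qed.
End Queries.

(** * Degrees of tuples and the greedy choice at one position *)

Section Degrees.
Variables (V : finType) (k : nat).
Implicit Types (A : {set 'I_k}) (G : {set {ffun 'I_k -> V}}) (e : {ffun 'I_k -> V}).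

Definition agree A e e0 := [forall i in A, e i == e0 i].
Definition deg G A e0 := #|[set e in G | agree A e e0]|.

Lemma agreeC A e e0 : agree A e e0 = agree A e0 e.
Proof. by apply: eq_forallb_in => i _; rewrite eq_sym. Qed.

Lemma deg_agree G A e0 e1 : agree A e0 e1 -> deg G A e0 = deg G A e1.
Proof.
move=> /forall_inP h; apply: eq_card => e; rewrite !inE; congr (_ && _).
by apply: eq_forallb_in => i /h/eqP->.
Qed.

Lemma degS G G' A e : G \subset G' -> (deg G A e <= deg G' A e)%N.
Proof.
by move=> sG; apply: subset_leq_card; apply/subsetP => f; rewrite !inE => /andP[/(subsetP sG)-> ->].
Qed.

(** Both sides count the pairs from [G] and [G'] that agree on [A]. *)
Lemma sum_deg G G' A : (\sum_(e in G) deg G' A e = \sum_(e in G') deg G A e)%N.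
Proof.
rewrite /deg; under eq_bigr do rewrite -sum1dep_card big_mkcondr.
rewrite exchange_big /=; under [RHS]eq_bigr do rewrite -sum1dep_card big_mkcondr.
by apply: eq_bigr => e _; apply: eq_bigr => f _; rewrite agreeC.
Qed.

Definition star G (s : 'I_k) (v : V) := [set e in G | e s == v].

Lemma card_star_sum G s : (#|G| = \sum_v #|star G s v|)%N.
Proof.
rewrite -sum1_card (partition_big (fun e => e s) xpredT) //=.
by apply: eq_bigr => v _; rewrite -sum1_card; apply: eq_bigl => e; rewrite inE.
Qed.
End Degrees.

Section Greedy.
Variables (R : realFieldType) (V : finType) (k : nat) (p KM d : R).
Variables (G : {set {ffun 'I_k -> V}}) (s : 'I_k) (P0 : {set 'I_k}).
Variable thr : {set 'I_k} -> R.
Hypotheses (sP0 : s \notin P0) (p0 : 0 < p) (KM0 : 0 < KM) (d0 : 0 < d).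
Hypothesis thr0 : forall A, 0 <= thr A.
Hypothesis degG : forall (A : {set 'I_k}) e, A \subset s |: P0 -> A != set0 ->
  (deg G A e)%:R <= KM * p ^+ #|A|.-1.
Implicit Types (st : {set V} * {set {ffun 'I_k -> V}}) (A : {set 'I_k}).

(** An edge stays available as long as none of its tuples at free positions is saturated by the
    edges [G'] collected so far. *)
Definition avail (G' : {set {ffun 'I_k -> V}}) := [set e in G | [forall A : {set 'I_k},
  (A \subset P0) && (A != set0) ==> ((deg G' A e)%:R < thr A)]].

Definition cand st := [set v | (v \notin st.1) && (d <= #|star (avail st.2) s v|%:R)].

Definition upd st v := (v |: st.1, st.2 :|: star (avail st.2) s v).

Definition inv (I : {set V}) st := [/\ st.1 \subset I, st.2 \subset G,
  forall e, e \in st.2 -> e s \in st.1,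
  d * #|st.1|%:R <= #|st.2|%:R <= #|st.1|%:R * KM
  & forall A e, A \subset P0 -> A != set0 ->
      (deg st.2 A e)%:R <= thr A + KM * p ^+ #|A|].

Lemma avail_sub G' : avail G' \subset G.
Proof. by apply/subsetP => e; rewrite inE => /andP[]. Qed.

Lemma star_le v : #|star G s v|%:R <= KM.
Proof.
have [->|/set0Pn[e]] := eqVneq (star G s v) set0; first by rewrite cards0 ltW.
rewrite inE => /andP[eG /eqP ev].
have /degG/(_ _) := subsetUl [set s] P0 => /(_ e); rewrite cards1 expr0 mulr1.
have -> : [set s] != set0 by apply/set0Pn; exists s; rewrite inE.
move=> /(_ isT); apply: le_trans; rewrite ler_nat subset_leq_card //.
apply/subsetP => f; rewrite !inE => /andP[-> /eqP fv] /=.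
by apply/forall_inP => i; rewrite inE => /eqP->; rewrite fv ev.
Qed.

(** A tuple on [A] gains edges only through an available edge, hence only while its degree is below
    [thr A]. One star adds at most the degree of a tuple on [s |: A] in [G], that is
    [KM * p ^+ #|A|], so the threshold is overshot at most once by this amount. *)
Lemma inv_upd I st v : inv I st -> v \in I -> v \in cand st -> inv I (upd st v).
Proof.
case: st => S G' [/= SI G'G eS /andP[lo hi] dg] vI; rewrite inE /= => /andP[vS dv].
set N := star (avail G') s v in dv *.
have NG : N \subset G.
  by apply/subsetP => e; rewrite inE => /andP[/(subsetP (avail_sub _))].
have cN : #|G' :|: N| = (#|G'| + #|N|)%N.
  rewrite cardsU [G' :&: N](_ : _ = set0) ?cards0 ?subn0 //.
  apply/setP => e; rewrite !inE; apply/negbTE; apply: contra vS.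
  by move=> /andP[/eS + /andP[_ /eqP <-]].
have hN : #|N|%:R <= KM.
  apply: le_trans (star_le v); rewrite ler_nat subset_leq_card //.
  apply/subsetP => e; rewrite !inE => /andP[/andP[-> _] ->] //.
rewrite /upd /inv /=; split.
- by rewrite subUset sub1set vI.
- by rewrite subUset G'G.
- by move=> e; rewrite inE => /orP[/eS h|]; rewrite !inE ?h ?orbT // => /andP[_ ->].
- rewrite cardsU1 vS cN !natrD mulrDr mulrDl mulr1 mul1r.
  by apply/andP; split; lra.
move=> A e AP A0.
have dU : (deg (G' :|: N) A e <= deg G' A e + deg N A e)%N.
  rewrite /deg; apply: leq_trans (leq_card_setU _ _); apply: subset_leq_card.
  by apply/subsetP => f; rewrite !inE => /andP[/orP[->|->] ->]; rewrite ?orbT.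
have [N0|] := posnP (deg N A e).
  by apply: le_trans (dg A e AP A0); rewrite ler_nat; move: dU; rewrite N0 addn0.
case/card_gt0P=> e1; rewrite inE => /andP[e1N ae1].
apply: (@le_trans _ _ ((deg G' A e)%:R + (deg N A e)%:R)); first by rewrite -natrD ler_nat.
move: (e1N); rewrite inE => /andP[]; rewrite inE => /andP[_ /forallP/(_ A)].
rewrite AP A0 /= (deg_agree _ ae1) => lt /eqP e1v.
apply: lerD; first exact: ltW.
have sA : s \notin A by apply: contra sP0 => /(subsetP AP).
have -> : #|A| = #|s |: A|.-1 by rewrite cardsU1 sA.
apply: le_trans (degG e1 (setUS [set s] AP) _); last by apply/set0Pn; exists s; rewrite !inE eqxx.
rewrite ler_nat; apply: subset_leq_card; apply/subsetP => f; rewrite !inE.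
move=> /andP[/andP[/andP[-> _] /eqP fv] /forall_inP h] /=; apply/forall_inP => i.
rewrite !inE => /orP[/eqP->|/[dup] iA /h/eqP->]; first by rewrite fv e1v.
by move/forall_inP/(_ i iA): ae1; rewrite eq_sym.
Qed.

Fixpoint greedy n st : alg V ({set V} * {set {ffun 'I_k -> V}}) :=
  if n is n'.+1 then bind (query (cand st))
    (fun o => if o is Some v then greedy n' (upd st v) else ret st)
  else ret st.

Lemma consistent_greedy n st : consistent (greedy n st).
Proof.
elim: n st => [|n IH] st /=; first exact: consistent_ret.
apply: consistent_bind => [|[v|]]; [exact: consistent_query | exact: IH | exact: consistent_ret].
Qed.

Lemma greedy_inv n st I : inv I st -> let r := greedy n st I in
  [/\ inv I r.2, r.2.1 = st.1 :|: r.1, (#|r.2.1| <= #|st.1| + n)%N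
    & #|r.2.1| = (#|st.1| + n)%N \/ [disjoint I & cand r.2]].
Proof.
elim: n st => [|n IH] st iv /=.
  by rewrite setU0 addn0; split=> //; left.
rewrite /bind /query; case: pickP => [v|none] /=.
  rewrite inE => /andP[vI vc]; have vS : v \notin st.1 by move: vc; rewrite inE => /andP[].
  have [iv' e2 le or] := IH _ (inv_upd iv vI vc).
  move: e2 le or; rewrite /= cardsU1 vS => e2 le or; split=> //.
  - by rewrite e2 setUCA setUA.
  - by apply: leq_trans le _; rewrite addnAC addnC addnA addn1.
  - by case: or => [->|]; [left; rewrite addnAC addnC addnA addn1 | right].
rewrite !setU0; split=> //; first exact: leq_addr.
right; rewrite -setI_eq0; apply/eqP/setP => v; have := none v.
by rewrite !inE.
Qed.

Lemma inv0 I : inv I (set0, set0).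
Proof.
rewrite /inv /=; split; rewrite ?sub0set ?cards0 ?mulr0 ?mul0r ?lexx //.
  by move=> e; rewrite inE.
move=> A e _ _; rewrite (_ : deg _ _ _ = 0%N); last first.
  by apply/eqP; rewrite cards_eq0; apply/eqP/setP => f; rewrite !inE.
by rewrite addr_ge0 // mulr_ge0 ?exprn_ge0 // ltW.
Qed.

(** Markov's inequality for each [A]: by double counting, the degrees of the edges of [G] into [G']
    sum to at most [#|G'| * KM * p ^+ #|A|.-1], which bounds the number of them that reach
    [thr A]. *)
Lemma card_killed (G' : {set {ffun 'I_k -> V}}) (X : R) : 0 <= X ->
  (forall A, A \subset P0 -> A != set0 ->
     #|G'|%:R * (KM * p ^+ #|A|.-1) <= X * thr A) ->
  (forall A, A \subset P0 -> A != set0 -> 0 < thr A) ->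
  #|G|%:R <= #|avail G'|%:R + (2 ^ k)%:R * X.
Proof.
move=> X0 hX th.
pose B (A : {set 'I_k}) : {set {ffun 'I_k -> V}} :=
  if (A \subset P0) && (A != set0) then [set e in G | thr A <= (deg G' A e)%:R] else set0.
have hB A : #|B A|%:R <= X.
  rewrite /B; case: ifP => [/andP[AP A0]|_]; last by rewrite cards0.
  rewrite -(ler_pM2r (th A AP A0)); apply: le_trans (hX A AP A0).
  apply: (@le_trans _ _ (\sum_(e in G) (deg G' A e)%:R)).
    rewrite mulr_natl -sumr_const [leRHS](bigID (fun e => thr A <= (deg G' A e)%:R)) /=.
    rewrite ler_wpDr ?sumr_ge0 //; under eq_bigl do rewrite inE.
    by apply: ler_sum => e /andP[].
  rewrite -natr_sum sum_deg natr_sum mulr_natl -sumr_const.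
  by apply: ler_sum => e _; apply: degG => //; apply: subset_trans AP (subsetUr _ _).
have sG : G \subset avail G' :|: \bigcup_A B A.
  apply/subsetP => e eG; rewrite !inE eG /=.
  rewrite -[X in X || _]negbK -implybE negb_forall; apply/implyP => /existsP[A].
  rewrite negb_imply -leNgt => /andP[hA hd]; apply/bigcupP; exists A => //.
  by rewrite /B hA inE eG.
apply: (@le_trans _ _ (#|avail G'|%:R + #|\bigcup_A B A|%:R)).
  by rewrite -natrD ler_nat; apply: leq_trans (subset_leq_card sG) (leq_card_setU _ _).
rewrite lerD2l; apply: (@le_trans _ _ (\sum_A #|B A|%:R)).
  rewrite -natr_sum ler_nat; elim/big_rec2: _ => [|A n Y _ le]; first by rewrite cards0.
  by apply: leq_trans (leq_card_setU _ _) _; rewrite leq_add2l.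
apply: le_trans (ler_sum _ (fun A _ => hB A)) _.
rewrite sumr_const -[leLHS]mulr_natl ler_wpM2r // ler_nat.
by rewrite -cardsT -powersetT card_powerset cardsT card_ord.
Qed.

Lemma card_avail st : #|avail st.2|%:R <=
  (#|st.1| + #|cand st|)%:R * KM + #|V|%:R * d.
Proof.
have h v : #|star (avail st.2) s v|%:R <= ((v \in st.1) + (v \in cand st))%:R * KM + d.
  have le : #|star (avail st.2) s v|%:R <= KM.
    apply: le_trans (star_le v); rewrite ler_nat subset_leq_card //.
    by apply/subsetP => e; rewrite !inE => /andP[/andP[-> _] ->].
  have [vS|vS] := boolP (v \in st.1).
    apply: le_trans le _; rewrite natrD mulrDl mul1r -addrA lerDl.
    by rewrite addr_ge0 ?mulr_ge0 // ltW.
  rewrite add0n inE vS /=; case: (leP d _) => [_|/ltW lt]; last by rewrite mul0r add0r.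
  by rewrite mul1r; apply: le_trans le _; rewrite lerDl ltW.
rewrite (card_star_sum _ s) natr_sum; apply: le_trans (ler_sum _ (fun v _ => h v)) _.
rewrite big_split /= sumr_const [X in _ <= _ + X]mulr_natl lerD2r -mulr_suml ler_wpM2r ?(ltW KM0) //.
rewrite -natr_sum ler_nat big_split /=.
have cE (A : {set V}) : (\sum_v (v \in A) = #|A|)%N.
  by rewrite -sum1_card [RHS]big_mkcond; apply: eq_bigr => v _; case: (_ \in _).
by rewrite !cE.
Qed.
End Greedy.

(** * Iteration over the positions and over rounds *)

Section Containers.
Variables (R : archiRealFieldType) (k : nat).

Definition deg_bound (V : finType) (p : R) (P : {set 'I_k})
    (G : {set {ffun 'I_k -> V}}) (K : R) :=
  forall (A : {set 'I_k}) e, A \subset P -> A != set0 ->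
    (deg G A e)%:R <= K * p ^+ #|A|.-1.

Definition next_const (kappa K : R) := K + (2 ^ (k + 3))%:R * K ^+ 2 / kappa.

Lemma level_step (V : finType) (p kappa K mu : R) (m : nat)
    (G : {set {ffun 'I_k -> V}}) (P : {set 'I_k}) s :
  0 < p -> 0 < kappa -> 0 < K -> 0 < mu -> 8 * K * p <= kappa ->
  p * #|V|%:R <= m%:R <= 2 * p * #|V|%:R -> (0 < m)%N -> s \in P ->
  kappa * mu * #|V|%:R <= #|G|%:R -> deg_bound p P G (K * mu) ->
  exists a : alg V ({set V} + {set {ffun 'I_k -> V}}), consistent a /\
  forall I, (#|(a I).1| <= m)%N /\
    match (a I).2 with
    | inl D => [/\ kappa / (4 * K) * #|V|%:R <= #|D|%:R, [disjoint D & I]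
                 & forall v, v \in D -> exists2 e, e \in G & e s = v]
    | inr G' => [/\ G' \subset G, forall e, e \in G' -> e s \in I,
                   kappa / 4 * (p * mu) * #|V|%:R <= #|G'|%:R
                 & deg_bound p (P :\ s) G' (next_const kappa K * (p * mu))]
    end.
Proof.
move=> p0 ka0 K0 mu0 Kp /andP[m1 m2] m0 sP hG dG.
pose L := (2 ^ (k + 3))%:R * K ^+ 2 / kappa.
have L0 : 0 < L by rewrite divr_gt0 // mulr_gt0 ?exprn_gt0 // ltr0n expn_gt0.
pose thr (A : {set 'I_k}) := L * mu * p ^+ #|A|.
pose d := kappa / 4 * mu.
have thr0 A : 0 < thr A by apply: mulr_gt0; [exact: mulr_gt0 | exact: exprn_gt0].
have d0 : 0 < d by rewrite mulr_gt0 // divr_gt0.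
have KM0 : 0 < K * mu by rewrite mulr_gt0.
have sP0 : s \notin P :\ s by rewrite !inE eqxx.
have dG' : forall (A : {set 'I_k}) e, A \subset s |: (P :\ s) -> A != set0 ->
  (deg G A e)%:R <= K * mu * p ^+ #|A|.-1 by move=> A e; rewrite setD1K //; apply: dG.
pose gr := greedy d G s (P :\ s) thr m (set0, set0).
exists (bind gr (fun st => ret (if #|st.1| == m then inr st.2
                                else inl (cand d G s (P :\ s) thr st)))); split.
  by apply: consistent_bind => [|st]; [exact: consistent_greedy | exact: consistent_ret].
move=> I; have thr0' A : 0 <= thr A by exact: ltW.
have iv0 := inv0 d G s (P :\ s) p0 KM0 thr0' I.
have := greedy_inv sP0 KM0 dG' m iv0.
rewrite -/gr /bind /=; case: (gr I) => S [S' G'] /= [[SI G'G eS /andP[lo hi] dg] eSS le or].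
move: eSS; rewrite set0U => eSS; rewrite setU0 -eSS.
rewrite cards0 add0n in le or; split=> //.
case: eqP or => [cS _|cS [//|dis]].
  split=> //.
  - by move=> e /eS /(subsetP SI).
  - apply: le_trans lo; rewrite /d cS.
    rewrite (_ : _ * (p * mu) * _ = kappa / 4 * mu * (p * #|V|%:R)); last by ring.
    by rewrite ler_wpM2l // ltW.
  - move=> A e AP A0; apply: le_trans (dg A e AP A0) _.
    have -> : p ^+ #|A| = p * p ^+ #|A|.-1.
      by rewrite -exprS prednK // card_gt0.
    rewrite /thr /next_const -/L [X in L * mu * X](_ : _ = p * p ^+ #|A|.-1); last first.
      by rewrite -exprS prednK // card_gt0.
    by rewrite le_eqVlt; apply/orP; left; apply/eqP; ring.
have V0 : 0 < #|V|%:R :> R.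
  have : 0 < m%:R :> R by rewrite ltr0n.
  by move=> /lt_le_trans/(_ m2); rewrite pmulr_rgt0 // mulr_gt0.
have S2 : #|S'|%:R <= 2 * p * #|V|%:R by apply: le_trans m2; rewrite ler_nat.
have killed : #|G|%:R <= #|avail G (P :\ s) thr G'|%:R + (2 ^ k)%:R * (kappa * mu * #|V|%:R / (4 * (2 ^ k)%:R)).
  apply: (card_killed dG').
  - by rewrite divr_ge0 // ?mulr_ge0 // ltW // ?mulr_gt0.
  - move=> A AP A0; rewrite /thr.
    have -> : p ^+ #|A| = p * p ^+ #|A|.-1 by rewrite -exprS prednK // card_gt0.
    rewrite [leRHS](_ : _ = (2 * p * #|V|%:R) * (K * mu) * (K * mu * p ^+ #|A|.-1)); last first.
      rewrite /L expnD natrM; field.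
      by rewrite gt_eqF //= pnatr_eq0 expn_eq0.
    apply: ler_wpM2r; first by rewrite mulr_ge0 ?exprn_ge0 // ltW.
    by apply: le_trans hi _; rewrite ler_wpM2r // ltW.
  - by move=> A _ _.
have k20 : (2 ^ k)%:R != 0 :> R by rewrite pnatr_eq0 expn_eq0.
rewrite [X in _ <= _ + X](_ : _ = kappa * mu * #|V|%:R / 4) in killed; last by field.
split.
- have ca := card_avail thr KM0 d0 dG' (S', G').
  rewrite /= natrD mulrDl in ca.
  set c := #|cand _ _ _ _ _ _|%:R in ca *.
  have S3 : #|S'|%:R * (K * mu) <= kappa * mu * #|V|%:R / 4.
    apply: le_trans (ler_wpM2r (ltW KM0) S2) _.
    rewrite (_ : _ * (K * mu) = 8 * K * p * (mu * #|V|%:R / 4)); last by field.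
    rewrite (_ : kappa * _ * _ / _ = kappa * (mu * #|V|%:R / 4)); last by field.
    by rewrite ler_wpM2r // mulr_ge0 ?invr_ge0 // mulr_ge0 // ltW.
  have h : kappa * mu * #|V|%:R / 4 <= c * (K * mu).
    rewrite (_ : #|V|%:R * d = kappa * mu * #|V|%:R / 4) in ca; last by rewrite /d; ring.
    by move: (kappa * mu * #|V|%:R) hG killed ca S3 => y hG killed ca S3; lra.
  rewrite -(ler_pM2r KM0); apply: le_trans h; rewrite le_eqVlt; apply/orP; left; apply/eqP.
  by field; rewrite gt_eqF.
- by rewrite disjoint_sym.
move=> v; rewrite inE /= => /andP[_ /(lt_le_trans d0)]; rewrite ltr0n => /card_gt0P[e].
by rewrite inE => /andP[/(subsetP (avail_sub _ _ _ _)) eG /eqP ev]; exists e.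
Qed.

(* Each level turns one free position into a position with values in [I] and
   scales the degrees by [p]; at the last level the remaining position avoids
   [I], because no edge lies in [I]. *)
Lemma free_containers n (kappa K : R) : 0 < kappa -> 0 < K ->
  exists eta p0 : R, [/\ 0 < eta, 0 < p0 &
  forall (V : finType) (p mu : R) (m : nat) (P : {set 'I_k})
    (G : {set {ffun 'I_k -> V}}),
  0 < p <= p0 -> 0 < mu -> p * #|V|%:R <= m%:R <= 2 * p * #|V|%:R -> (0 < m)%N ->
  #|P| = n.+1 -> kappa * mu * #|V|%:R <= #|G|%:R -> deg_bound p P G (K * mu) ->
  exists a : alg V {set V}, consistent a /\
  forall I : {set V}, (forall e i, e \in G -> i \notin P -> e i \in I) ->
    (forall e, e \in G -> exists i : 'I_k, e i \notin I) ->
    [/\ (#|(a I).1| <= n * m)%N, eta * #|V|%:R <= #|(a I).2|%:R, [disjoint (a I).2 & I]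
      & forall v, v \in (a I).2 -> exists2 e, e \in G & exists i : 'I_k, e i = v]].
Proof.
elim: n kappa K => [|n IH] kappa K ka0 K0.
  exists (kappa / K), 1; split=> //; first exact: divr_gt0.
  move=> V p mu m P G _ mu0 _ m0 /eqP/cards1P[s ->] hG dG.
  exists (ret [set (e : {ffun 'I_k -> V}) s | e in G]); split; first exact: consistent_ret.
  move=> I eI nI; rewrite /= cards0; split=> //.
  - have KM0 : 0 < K * mu by rewrite mulr_gt0.
    rewrite -(ler_pM2r KM0); apply: (@le_trans _ _ (kappa * mu * #|V|%:R)).
      by rewrite le_eqVlt; apply/orP; left; apply/eqP; field; rewrite gt_eqF.
    apply: le_trans hG _.
    rewrite -sum1_card (partition_big (fun e : {ffun 'I_k -> V} => e s)
      (mem [set (e : {ffun 'I_k -> V}) s | e in G])) /=; last by move=> e eG; apply: imset_f.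
    rewrite natr_sum mulr_natl -sumr_const; apply: ler_sum => v /imsetP[e0 e0G ->].
    have s0 : [set s] != set0 by apply/set0Pn; exists s; rewrite inE.
    have := dG [set s] e0 (subxx _) s0; rewrite cards1 expr0 mulr1; apply: le_trans.
    rewrite ler_nat sum1dep_card; apply: subset_leq_card; apply/subsetP => e.
    rewrite !inE => /andP[-> /eqP es] /=; apply/forall_inP => i.
    by rewrite inE => /eqP->; rewrite es.
  - rewrite -setI_eq0 -subset0; apply/subsetP => v; rewrite inE => /andP[/imsetP[e eG ->] esI].
    have [i ni] := nI e eG; have [is_|is_] := eqVneq i s.
      by rewrite is_ esI in ni.
    by rewrite eI // inE in ni.
  - by move=> v /imsetP[e eG ->]; exists e => //; exists s.
set K' := next_const kappa K.
have K'0 : 0 < K'.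
  by rewrite addr_gt0 // divr_gt0 // mulr_gt0 ?exprn_gt0 // ltr0n expn_gt0.
have ka4 : 0 < kappa / 4 by rewrite divr_gt0.
have [eta [p0 [eta0 p00 H]]] := IH _ _ ka4 K'0.
exists (Num.min (kappa / (4 * K)) eta), (Num.min (kappa / (8 * K)) p0); split.
- by rewrite lt_min eta0 andbT divr_gt0 // mulr_gt0.
- by rewrite lt_min p00 andbT divr_gt0 // mulr_gt0.
move=> V p mu m P G /andP[p_gt0]; rewrite le_min => /andP[pK pp0] mu0 hm m0 cP hG dG.
have [s sP] : exists s, s \in P by apply/card_gt0P; rewrite cP.
have pK' : 8 * K * p <= kappa.
  by rewrite mulrC -ler_pdivlMr // mulr_gt0.
have [a [ca ha]] := level_step p_gt0 ka0 K0 mu0 pK' hm m0 sP hG dG.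
have Pmu0 : 0 < p * mu by rewrite mulr_gt0.
have cPs : #|P :\ s| = n.+1 by move: cP; rewrite (cardsD1 s) sP => -[].
pose good (G' : {set {ffun 'I_k -> V}}) := kappa / 4 * (p * mu) * #|V|%:R <= #|G'|%:R /\
  deg_bound p (P :\ s) G' (K' * (p * mu)).
(* Finite choice requires an algorithm for every [G']; those violating the bounds receive the
   trivial one. *)
have : forall G' : {set {ffun 'I_k -> V}}, exists a' : alg V {set V}, consistent a' /\ (good G' ->
  forall I : {set V}, (forall e i, e \in G' -> i \notin P :\ s -> e i \in I) ->
    (forall e, e \in G' -> exists i : 'I_k, e i \notin I) ->
    [/\ (#|(a' I).1| <= n * m)%N, eta * #|V|%:R <= #|(a' I).2|%:R, [disjoint (a' I).2 & I]
      & forall v, v \in (a' I).2 -> exists2 e, e \in G' & exists i : 'I_k, e i = v]).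
  move=> G'; pose d1 := kappa / 4 * (p * mu) * #|V|%:R <= #|G'|%:R.
  pose d2 := [forall A : {set 'I_k}, forall e, (A \subset P :\ s) ==> (A != set0) ==>
    ((deg G' A e)%:R <= K' * (p * mu) * p ^+ #|A|.-1)].
  have [g1|g1] := boolP d1; last first.
    by exists (ret set0); split=> [|[]]; [exact: consistent_ret | rewrite -/d1 (negbTE g1)].
  have [/forallP g2|g2] := boolP d2; last first.
    exists (ret set0); split=> [|[_ g]]; first exact: consistent_ret.
    case/negP: g2; apply/forallP => A; apply/forallP => e; apply/implyP => h1.
    by apply/implyP => h2; apply: g.
  have g3 : deg_bound p (P :\ s) G' (K' * (p * mu)).
    by move=> A e h1 h2; have /forallP/(_ e) := g2 A; rewrite h1 h2.
  have hp : 0 < p <= p0 by rewrite p_gt0.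
  have [a' [ca' ha']] := H V p (p * mu) m _ G' hp Pmu0 hm m0 cPs g1 g3.
  by exists a'.
move=> /fin_all_exists[f hf].
exists (bind a (fun x => match x with inl D => ret D | inr G' => f G' end)); split.
  apply: consistent_bind => // -[D|G']; [exact: consistent_ret | by case: (hf G')].
move=> I eI nI; have [sz] := ha I; rewrite /bind; case: (a I).2 => [D|G'] /=.
  case=> [cD dD De]; rewrite setU0; split=> //.
  - by apply: leq_trans sz _; rewrite mulSn leq_addr.
  - by apply: le_trans cD; rewrite ler_wpM2r // ge_min lexx.
  - by move=> v /De[e eG es]; exists e => //; exists s.
case=> G'G G's cG' dG'; have [_ /(_ (conj cG' dG') I)] := hf G'.
case=> [e i eG'|e eG'|sz2 cD dD De].
- rewrite !inE negb_and negbK => /orP[/eqP->|iP]; first exact: G's.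
  by apply: eI => //; apply: (subsetP G'G).
- exact/nI/(subsetP G'G).
split=> //.
- by apply: leq_trans (leq_card_setU _ _) _; rewrite mulSn leq_add.
- by apply: le_trans cD; rewrite ler_wpM2r // ge_min lexx orbT.
- by move=> v /De[e eG' h]; exists e => //; apply: (subsetP G'G).
Qed.

Definition avoiding (V : finType) (E : {set {ffun 'I_k -> V}}) (D : {set V}) :=
  [set e in E | [forall i, e i \notin D]].

(** Each round treats the edges avoiding the current set and enlarges it by a disjoint set of at
    least [eta * #|V|] vertices. Since [t * eta > 1], after [t] rounds there is no room left, so few
    edges avoid the set. A round queries [k - 1] positions, the last one being free of charge; this
    gives [c0]. *)
Lemma containers (b delta : R) : (0 < k)%N -> 0 < b -> 0 < delta ->
  exists c0 : nat, exists2 p0 : R, 0 < p0 &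
  forall (V : finType) (p : R) (m : nat) (E : {set {ffun 'I_k -> V}}),
  0 < p <= p0 -> p * #|V|%:R <= m%:R <= 2 * p * #|V|%:R -> (0 < m)%N -> E != set0 ->
  deg_bound p setT E (b * (#|E|%:R / #|V|%:R)) ->
  exists D : {set V} -> {set V}, forall I : {set V}, (forall e, e \in E -> exists i : 'I_k, e i \notin I) ->
    exists S : {set V}, [/\ S \subset I, (#|S| <= c0 * m)%N, [disjoint D S & I]
      & #|avoiding E (D S)|%:R <= delta * #|E|%:R].
Proof.
move=> k0 b0 de0.
have [eta [p0 [eta0 p00 H]]] := free_containers k.-1 de0 b0.
have [t ht] : exists t : nat, 1 < t%:R * eta.
  exists (Num.bound eta^-1); rewrite -ltr_pdivrMr // mul1r.
  by apply: archi_boundP; rewrite invr_ge0 ltW.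
exists (t * k.-1)%N, p0 => // V p m E hp hm m0 E0 dE.
have E00 : 0 < #|E|%:R :> R by rewrite ltr0n card_gt0.
have V00 : 0 < #|V|%:R :> R.
  case/andP: hp => p_gt0 _; case/andP: hm => _ m2.
  have : 0 < m%:R :> R by rewrite ltr0n.
  by move=> /lt_le_trans/(_ m2); rewrite pmulr_rgt0 // mulr_gt0.
set mu := #|E|%:R / #|V|%:R in dE.
have mu0 : 0 < mu by rewrite divr_gt0.
have cT : #|[set: 'I_k]| = k.-1.+1 by rewrite cardsT card_ord prednK.
suff Hn n : exists a : alg V {set V}, consistent a /\
    forall I : {set V}, (forall e, e \in E -> exists i : 'I_k, e i \notin I) ->
    [/\ (#|(a I).1| <= n * k.-1 * m)%N, [disjoint (a I).2 & I]
      & n%:R * eta * #|V|%:R <= #|(a I).2|%:R \/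
        #|avoiding E (a I).2|%:R <= delta * #|E|%:R].
  (* The container is obtained by running the algorithm on the fingerprint alone. *)
  have [a [ca ha]] := Hn t; exists (fun S => (a S).2) => I nI.
  have [sz dis or] := ha I nI; have [sI cons] := ca I.
  exists (a I).1; rewrite cons //; split=> //; case: or => // or.
  have : #|(a I).2|%:R <= #|V|%:R :> R by rewrite ler_nat max_card.
  move=> /(le_trans or); rewrite -[leRHS]mul1r ler_pM2r //.
  by rewrite leNgt ht.
elim: n => [|n [a [ca ha]]].
  exists (ret set0); split=> [|I nI]; first exact: consistent_ret.
  rewrite /= cards0 !mul0r; split=> //; last by left.
  by rewrite -setI_eq0 set0I.
have : forall D : {set V}, exists a' : alg V {set V}, consistent a' /\
  (delta * #|E|%:R < #|avoiding E D|%:R ->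
  forall I : {set V}, (forall e, e \in E -> exists i : 'I_k, e i \notin I) ->
    [/\ (#|(a' I).1| <= k.-1 * m)%N, eta * #|V|%:R <= #|(a' I).2|%:R, [disjoint (a' I).2 & I]
      & [disjoint D & (a' I).2]]).
  move=> D; have [big|small] := ltP (delta * #|E|%:R) #|avoiding E D|%:R; last first.
    by exists (ret set0); split=> //; exact: consistent_ret.
  have sE : avoiding E D \subset E by apply/subsetP => e; rewrite inE => /andP[].
  have hE : delta * mu * #|V|%:R <= #|avoiding E D|%:R.
    by rewrite /mu -mulrA divfK ?ltW // gt_eqF.
  have dE' : deg_bound p setT (avoiding E D) (b * mu).
    by move=> A e AT A0; apply: le_trans (dE A e AT A0); rewrite ler_nat degS.
  have [a' [ca' ha']] := H V p mu m setT _ hp mu0 hm m0 cT hE dE'.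
  exists a'; split=> // _ I nI.
  have [||sz cD dD De] := ha' I.
  - by move=> e i _; rewrite inE.
  - by move=> e /(subsetP sE); apply: nI.
  split=> //; rewrite -setI_eq0 -subset0; apply/subsetP => v; rewrite inE => /andP[vD].
  by case/De=> e; rewrite inE => /andP[_ /forallP h] [i ei]; move: (h i); rewrite ei vD.
move=> /fin_all_exists[f hf].
pose g (D : {set V}) : alg V {set V} :=
  if #|avoiding E D|%:R <= delta * #|E|%:R then ret D
  else bind (f D) (fun D' => ret (D :|: D')).
exists (bind a g); split.
  apply: consistent_bind => // D; rewrite /g; case: ifP => _; first exact: consistent_ret.
  by apply: consistent_bind => [|D']; [case: (hf D) | exact: consistent_ret].
move=> I nI; have [sz dis or] := ha I nI; rewrite /bind /g.
case: (leP _ _) => [small|big] /=.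
  rewrite setU0; split=> //; last by right.
  by apply: leq_trans sz _; rewrite !leq_mul2r leqnSn !orbT.
have [_ /(_ big I nI)[sz2 cD dD dDD]] := hf (a I).2.
rewrite setU0; split.
- by apply: leq_trans (leq_card_setU _ _) _; rewrite mulSn mulnDl addnC leq_add.
- by rewrite -setI_eq0 setIUl setU_eq0 !setI_eq0 dis.
left; rewrite cardsU (disjoint_setI0 dDD) cards0 subn0 natrD.
case: or => [or|]; last by rewrite leNgt big.
by rewrite -natr1 !mulrDl mul1r lerD.
Qed.
End Containers.

(** * Ordered hypergraphs *)

Section Link.
Variables (k : nat) (H : ohgraph k).
Implicit Types (W X Y A : {set 'I_k}) (e : {ffun 'I_k -> vert H}).

Lemma enum_val_sur W (i : 'I_k) : i \in W -> exists j : 'I_#|W|, enum_val j = i.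
Proof. by move=> iW; exists (enum_rank_in iW i); rewrite enum_rankK_in. Qed.

Lemma restr_edge_agree W e e' : reflect {in W, e =1 e'} (restr_edge W e == restr_edge W e').
Proof.
apply: (iffP eqP) => [h i /enum_val_sur[j <-]|h].
  by move/ffunP/(_ j): h; rewrite !ffunE.
by apply/ffunP => j; rewrite !ffunE h // enum_valP.
Qed.

Lemma restr_edge_in W e : e \in edges H -> restr_edge W e \in edges (restr H W).
Proof. exact: imset_f. Qed.

Lemma restr_edgeP W f : f \in edges (restr H W) ->
  exists2 e, e \in edges H & f = restr_edge W e.
Proof. by case/imsetP=> e eH ->; exists e. Qed.

Lemma deletes_to_restr W Y e e' : {in W, e =1 e'} ->
  deletes_to (restr_edge Y e) (restr_edge W e').
Proof.
move=> h; apply/forallP => i; apply/forallP => j; apply/implyP => /eqP ij.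
by rewrite !ffunE ij h // enum_valP.
Qed.

Lemma card_restr_le W : (#|edges (restr H W)| <= #|edges H|)%N.
Proof. exact: leq_imset_card. Qed.

Lemma card_restr_gt0 W : edges H != set0 -> (0 < #|edges (restr H W)|)%N.
Proof.
by case/set0Pn=> e eH; apply/card_gt0P; exists (restr_edge W e); apply: restr_edge_in.
Qed.

Lemma deg_le_Delta A e : (deg (edges H) A e <= Delta H A setT)%N.
Proof.
have [->//|] := posnP (deg (edges H) A e).
case/card_gt0P=> e1; rewrite inE => /andP[e1H ae].
rewrite (deg_agree _ (_ : agree A e e1)); last by rewrite agreeC.
apply: leq_trans (leq_bigmax_cond _ (restr_edge_in A e1H)).
have inj : injective (@restr_edge k (vert H) setT).
  by move=> f g /eqP/restr_edge_agree h; apply/ffunP => i; apply: h; rewrite inE.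
rewrite /deg -[leqLHS](card_imset _ inj).
apply: subset_leq_card; apply/subsetP => _ /imsetP[f + ->]; rewrite inE => /andP[fH /forall_inP h].
rewrite inE restr_edge_in //=; apply: deletes_to_restr => i iA.
by rewrite (eqP (h i iA)).
Qed.

Definition shadow X : {set {set vert H}} := [set e @: X | e : {ffun 'I_k -> vert H} in edges H].

Lemma shadow_card X g : g \in shadow X -> #|g| = #|X|.
Proof. by case/imsetP=> e eH ->; rewrite card_imset //; apply: edges_inj. Qed.

Lemma imset_restr X e : [set restr_edge X e j | j : 'I_#|X|] = e @: X.
Proof.
apply/setP => v; apply/imsetP/imsetP => [[j _ ->]|[i iX ->]].
  by exists (enum_val j); rewrite ?enum_valP ?ffunE.
by have [j <-] := enum_val_sur iX; exists j; rewrite ?ffunE.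
Qed.

Lemma shadowE X : shadow X =
  [set [set f j | j : 'I_#|X|] | f : {ffun 'I_#|X| -> vert H} in edges (restr H X)].
Proof.
apply/setP => g; apply/imsetP/imsetP => [[e eH ->]|[f /restr_edgeP[e eH ->] ->]].
  by exists (restr_edge X e); rewrite ?imset_restr ?restr_edge_in.
by exists e; rewrite ?imset_restr.
Qed.

Lemma card_shadow X : (#|shadow X| <= #|edges (restr H X)|)%N.
Proof. by rewrite shadowE leq_imset_card. Qed.

Definition max_Delta X w := (\max_(W : {set 'I_k} | (W \subset X) && (#|W| == w)) Delta H W X)%N.

(** A subset [A] of an unordered edge occupies some positions [W] in [X], at most [2 ^ k] choices,
    in some order, at most [k ^ k] choices; then at most [Delta H W X] edges remain. *)
Lemma shadow_deg X (A : {set vert H}) :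
  (#|[set g in shadow X | A \subset g]| <= 2 ^ k * k ^ k * max_Delta X #|A|)%N.
Proof.
pose E := [set f in edges (restr H X) | A \subset [set f j | j : 'I_#|X|]].
have sE : [set g in shadow X | A \subset g] \subset
    [set [set f j | j : 'I_#|X|] | f : {ffun 'I_#|X| -> vert H} in E].
  apply/subsetP => g; rewrite inE shadowE => /andP[/imsetP[f fX ->] Ag].
  by apply: imset_f; rewrite inE fX.
apply: leq_trans (subset_leq_card sE) _; apply: leq_trans (leq_imset_card _ _) _.
pose T W := \bigcup_(f in [set f in edges (restr H W) | f \in ffun_on (mem A)])
  [set e in edges (restr H X) | deletes_to e f].
have sT : E \subset \bigcup_(W : {set 'I_k} | (W \subset X) && (#|W| == #|A|)) T W.
  apply/subsetP => f; rewrite inE => /andP[/restr_edgeP[e eH ->]]; rewrite imset_restr => Ae.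
  pose W := [set i in X | e i \in A].
  have eW : e @: W = A.
    apply/setP => v; apply/imsetP/idP => [[i + ->]|vA]; first by rewrite inE => /andP[].
    have /imsetP[i iX vi] := subsetP Ae v vA.
    by exists i => //; rewrite inE iX -vi.
  apply/bigcupP; exists W.
    rewrite -{1}eW card_imset ?eqxx ?andbT; last exact: edges_inj.
    by apply/subsetP => i; rewrite inE => /andP[].
  apply/bigcupP; exists (restr_edge W e).
    rewrite inE restr_edge_in //=; apply/ffun_onP => j; rewrite ffunE.
    by have := enum_valP j; rewrite inE => /andP[].
  by rewrite inE restr_edge_in //=; apply: deletes_to_restr.
have leU (I J : finType) (P : pred I) (F : I -> {set J}) :
    (#|\bigcup_(i | P i) F i| <= \sum_(i | P i) #|F i|)%N.
  elim/big_rec2: _ => [|i n U _ le]; first by rewrite cards0.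
  by apply: leq_trans (leq_card_setU _ _) _; rewrite leq_add2l.
apply: leq_trans (subset_leq_card sT) _; apply: leq_trans (leU _ _ _ _) _.
have hT W : (W \subset X) && (#|W| == #|A|) -> (#|T W| <= k ^ k * max_Delta X #|A|)%N.
  move=> hW; apply: leq_trans (leU _ _ _ _) _.
  apply: (@leq_trans (\sum_(f in [set f in edges (restr H W) | f \in ffun_on (mem A)]) Delta H W X)).
    apply: leq_sum => f; rewrite inE => /andP[fW _].
    by apply: leq_trans (leq_bigmax_cond _ fW).
  rewrite sum_nat_const; apply: leq_mul; last by rewrite /max_Delta (bigD1 W hW) leq_maxl.
  apply: (@leq_trans #|(ffun_on (mem A) : simpl_pred {ffun 'I_#|W| -> vert H})|).
    by apply: subset_leq_card; apply/subsetP => f; rewrite inE => /andP[].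
  case/andP: hW => _ /eqP cW.
  rewrite card_ffun_on card_ord -cW.
  have Wk : (#|W| <= k)%N by rewrite -[k in leqRHS]card_ord max_card.
  have [->|W0] := posnP #|W|; first by rewrite expn0; case: (k) => // ?; rewrite expn_gt0.
  apply: (@leq_trans (k ^ #|W|)); first by rewrite leq_exp2r.
  by rewrite leq_pexp2l // (leq_trans W0).
apply: (@leq_trans (\sum_(W : {set 'I_k} | (W \subset X) && (#|W| == #|A|)) k ^ k * max_Delta X #|A|)).
  exact: leq_sum.
rewrite sum_nat_const -mulnA leq_mul2r; apply/orP; right.
apply: leq_trans (max_card _) _.
by rewrite -cardsT -powersetT card_powerset cardsT card_ord.
Qed.

(** Two of the [r] colours suffice: every surviving edge already shows both of them on its positions
    in [X]. *)
Lemma colourable_not_Ramsey X r (S : {set vert H}) : (2 <= r)%N ->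
  colourable (inside (shadow X) S) -> ~~ Ramsey r (induced S).
Proof.
move=> r2 /existsP[T /forall_inP hT].
pose c : {ffun vert (induced S) -> 'I_r} :=
  [ffun x => if val x \in T then Ordinal (ltnW r2) else Ordinal r2].
apply/negP => /forallP/(_ c)/exists_inP[e]; rewrite inE => eH /forallP mo.
have gX : [set val (e i) | i in X] \in inside (shadow X) S.
  rewrite inE; apply/andP; split.
    by apply/imsetP; exists [ffun i => val (e i)] => //; apply: eq_imset => i; rewrite ffunE.
  by apply/subsetP => _ /imsetP[i _ ->]; apply: valP.
have /andP[/set0Pn[v hv] /set0Pn[w hw]] := hT _ gX.
move: hv hw; rewrite in_setI in_setD => /andP[/imsetP[i _ ->] iT] /andP[+ /imsetP[j _ ej]].
rewrite ej => jT; have /forallP/(_ j) := mo i.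
by rewrite !ffunE iT (negbTE jT) -val_eqE.
Qed.

Lemma not_Ramsey_independent r (S : {set vert H}) : ~~ Ramsey r (induced S) ->
  exists I : {ffun 'I_r -> {set vert H}},
    [/\ forall i, I i \subset S, forall v, v \in S -> exists i, v \in I i
      & forall i e, e \in edges H -> exists j : 'I_k, e j \notin I i].
Proof.
rewrite negb_forall => /existsP[c /exists_inPn hc].
pose J (i : 'I_r) := [set v | [exists x : vert (induced S), (val x == v) && (c x == i)]].
exists [ffun i => J i]; split.
- move=> i; rewrite ffunE; apply/subsetP => v; rewrite inE => /existsP[x /andP[/eqP<- _]].
  exact: valP.
- move=> v vS; exists (c (Sub v vS)); rewrite ffunE inE; apply/existsP; exists (Sub v vS).
  by rewrite SubK !eqxx.
move=> i e eH; apply/existsP; rewrite -negb_forall; apply/negP => /forallP.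
rewrite ffunE => h.
have hS j : e j \in S by have := h j; rewrite inE => /existsP[x /andP[/eqP<- _]]; exact: valP.
pose e' : {ffun 'I_k -> vert (induced S)} := [ffun j => Sub (e j) (hS j)].
have ci j : c (e' j) = i.
  have := h j; rewrite inE => /existsP[x /andP[/eqP xe /eqP <-]]; congr (c _).
  by apply: val_inj; rewrite ffunE SubK xe.
have /negP[] : ~~ mono c e'.
  apply: hc; rewrite inE.
  by rewrite (_ : [ffun _ => _] = e) //; apply/ffunP => j; rewrite !ffunE SubK.
by apply/forallP => j; apply/forallP => l; rewrite !ci.
Qed.
End Link.

(** * Supersaturation and the union bound over fingerprints *)

Section Supersaturation.
Variables (R : realType) (k : nat) (H : ohgraph k).

(** Colour each vertex outside [Z] by some [i] with [v] outside [D i]. A monochromatic edge then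
    either avoids one [D i] or meets [Z]. The former are few by [hD], so supersaturation makes the
    latter many, and by the degree bound [Z] is large. *)
Lemma uncovered_large r (eps b delta p : R) (D : {ffun 'I_r -> {set vert H}}) :
  (0 < k)%N -> (0 < r)%N -> 0 < b -> edges H != set0 -> supersaturated r eps H ->
  deg_bound p setT (edges H) (b * (#|edges H|%:R / #|vert H|%:R)) ->
  (forall i, #|avoiding (edges H) (D i)|%:R <= delta * #|edges H|%:R) ->
  (eps - r%:R * delta) * #|vert H|%:R <= k%:R * b * #|\bigcap_i D i|%:R.
Proof.
move=> k0 r0 b0 E0 ss dE hD; set Z := \bigcap_i D i; set E := edges H in E0 dE hD *.
have E00 : 0 < #|E|%:R :> R by rewrite ltr0n card_gt0.
pose i0 := Ordinal k0.
have [e0 e0E] := set0Pn _ E0.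
have V0 : 0 < #|vert H|%:R :> R by rewrite ltr0n; apply/card_gt0P; exists (e0 i0).
pose c : {ffun vert H -> 'I_r} :=
  [ffun v => odflt (Ordinal r0) [pick i | v \notin D i]].
have cP v : v \notin Z -> v \notin D (c v).
  move=> vZ; rewrite ffunE; case: pickP => //= none; case/negP: vZ.
  by apply/bigcapP => i _; have := none i => /negbFE.
set KM := b * (#|E|%:R / #|vert H|%:R) in dE.
have sl j v : #|star E j v|%:R <= KM.
  have [->|/set0Pn[e]] := eqVneq (star E j v) set0.
    by rewrite cards0 mulr_ge0 ?divr_ge0 // ltW.
  rewrite inE => /andP[eE /eqP ev].
  have j0 : [set j] != set0 by apply/set0Pn; exists j; rewrite inE.
  have := dE [set j] e (subsetT _) j0; rewrite cards1 expr0 mulr1; apply: le_trans.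
  rewrite ler_nat; apply: subset_leq_card; apply/subsetP => f; rewrite !inE => /andP[-> /eqP fv] /=.
  by apply/forall_inP => i; rewrite inE => /eqP->; rewrite fv ev.
have sub : [set e in E | mono c e] \subset
    (\bigcup_i avoiding E (D i)) :|: (\bigcup_j \bigcup_(v in Z) star E j v).
  apply/subsetP => e; rewrite in_set => /andP[eE /forallP mo]; rewrite in_setU.
  have [/existsP[j ejZ]|/existsPn h] := boolP [exists j, e j \in Z].
    apply/orP; right; apply/bigcupP; exists j => //; apply/bigcupP; exists (e j) => //.
    by rewrite inE eE eqxx.
  apply/orP; left; apply/bigcupP; exists (c (e i0)) => //; rewrite inE eE.
  apply/forallP => j; have /forallP/(_ j)/eqP -> := mo i0.
  exact/cP/h.
have leU (I J : finType) (P : pred I) (F : I -> {set J}) :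
    #|\bigcup_(i | P i) F i|%:R <= \sum_(i | P i) #|F i|%:R :> R.
  elim/big_rec2: _ => [|i n U _ le]; first by rewrite cards0.
  apply: (@le_trans _ _ (#|F i|%:R + #|U|%:R)); last by rewrite lerD2l.
  by rewrite -natrD ler_nat leq_card_setU.
have h1 : eps * #|E|%:R <= r%:R * (delta * #|E|%:R) + k%:R * (#|Z|%:R * KM).
  apply: le_trans (ss c) _.
  apply: (@le_trans _ _ (#|\bigcup_i avoiding E (D i)|%:R + #|\bigcup_j \bigcup_(v in Z) star E j v|%:R)).
    by rewrite -natrD ler_nat; apply: leq_trans (subset_leq_card sub) (leq_card_setU _ _).
  apply: lerD; apply: le_trans (leU _ _ _ _) _.
    apply: le_trans (ler_sum _ (fun i _ => hD i)) _.
    by rewrite sumr_const card_ord mulr_natl.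
  apply: (@le_trans _ _ (\sum_(j < k) #|Z|%:R * KM)); last by rewrite sumr_const card_ord [leRHS]mulr_natl.
  apply: ler_sum => j _; apply: le_trans (leU _ _ _ _) _.
  apply: le_trans (ler_sum _ (fun v _ => sl j v)) _.
  by rewrite sumr_const mulr_natl.
rewrite -(ler_pM2r E00); rewrite -(ler_pM2r V0) in h1.
have -> : k%:R * b * #|Z|%:R * #|E|%:R = k%:R * (#|Z|%:R * KM) * #|vert H|%:R.
  by rewrite /KM; field; rewrite gt_eqF.
have -> : (eps - r%:R * delta) * #|vert H|%:R * #|E|%:R =
  eps * #|E|%:R * #|vert H|%:R - r%:R * (delta * #|E|%:R) * #|vert H|%:R by ring.
by move: h1; rewrite [leRHS]mulrDl lerBlDl.
Qed.

Variable q : R.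
Hypothesis q01 : 0 <= q <= 1.

Lemma sum_keep_weight : \sum_(S : {set vert H}) keep_weight q S = 1.
Proof.
have eP : \prod_(v : vert H) (q + (1 - q)) =
  \sum_(J in {set vert H}) \prod_i (if i \in J then q else 1 - q) by exact: bigA_distr.
rewrite big1 in eP; last by move=> v _; rewrite addrC subrK.
rewrite eP; apply: eq_bigr => S _; rewrite (bigID (mem S)) /=.
rewrite (eq_bigr (fun=> q)) ?prodr_const => [|v ->//].
rewrite [X in _ = _ * X](eq_bigr (fun=> 1 - q)) ?prodr_const => [|v /negbTE->//].
by congr (_ * _ ^+ _); apply: eq_card => v; rewrite !inE.
Qed.

(** As in Chernoff bounds, each term is multiplied by [la ^+ (h - #|T|) >= 1]; the sum over all [T]
    then factors as a product over [V]. *)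
Lemma sum_exp_card (V : finType) (y la : R) (h : nat) : 0 <= y -> 1 <= la ->
  \sum_(T : {set V} | (#|T| <= h)%N) y ^+ #|T| <= la ^+ h * (1 + y / la) ^+ #|V|.
Proof.
move=> y0 la1; have la0 : 0 < la by apply: lt_le_trans la1.
have eP : \prod_(v : V) (y / la + 1) =
  \sum_(J in {set V}) \prod_i (if i \in J then y / la else 1) by exact: bigA_distr.
rewrite prodr_const in eP.
rewrite addrC eP mulr_sumr [leRHS](bigID (fun T : {set V} => #|T| <= h)%N) /=.
apply: ler_wpDr.
  apply: sumr_ge0 => T _; apply: mulr_ge0; first exact/exprn_ge0/ltW.
  apply: prodr_ge0 => v _.
  by case: ifP => // _; rewrite divr_ge0 // ltW.
apply: ler_sum => T hT; rewrite -big_mkcond /= prodr_const expr_div_n mulrCA.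
rewrite ler_peMr ?exprn_ge0 // -(subnK hT) exprD mulfK ?expf_neq0 ?gt_eqF //.
by rewrite exprn_ege1.
Qed.

(** The random set contains the fingerprints of its [r] colour classes and avoids the intersection
    of the corresponding sets [D]. The [r]-tuples of fingerprints are grouped by their union [T]; at
    most [2 ^ (r * #|T|)] tuples share it, whence [2 ^+ r * q]. *)
Lemma prob_not_Ramsey_le r (D : {set vert H} -> {set vert H}) (good : pred {set vert H})
    (h : nat) (la wz : R) : 1 <= la -> 0 <= wz ->
  (forall I : {set vert H}, (forall e, e \in edges H -> exists j : 'I_k, e j \notin I) ->
     exists S : {set vert H},
       [/\ S \subset I, (#|S| <= h)%N, [disjoint D S & I] & good (D S)]) ->
  (forall F : {ffun 'I_r -> {set vert H}}, (forall i, good (D (F i))) ->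
     (1 - q) ^+ #|\bigcap_i D (F i)| <= wz) ->
  \sum_(S : {set vert H} | ~~ Ramsey r (induced S)) keep_weight q S
  <= wz * (la ^+ (r * h) * (1 + 2 ^+ r * q / la) ^+ #|vert H|).
Proof.
case/andP: (q01) => q0 q1 la1 wz0 cont hz.
pose K (F : {ffun 'I_r -> {set vert H}}) := [forall i, (#|F i| <= h)%N && good (D (F i))].
pose Q (F : {ffun 'I_r -> {set vert H}}) (S : {set vert H}) :=
  (\bigcup_i F i \subset S) && [disjoint S & \bigcap_i D (F i)].
apply: le_trans (sum_union_bound (K := K) (Q := Q) (keep_weight_ge0 q01) _) _.
  move=> S /not_Ramsey_independent[I [IS cov ind]].
  have /fin_all_exists[f hf] : forall i, exists S : {set vert H},
      [/\ S \subset I i, (#|S| <= h)%N, [disjoint D S & I i] & good (D S)].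
    by move=> i; apply: cont => e; apply: ind.
  exists [ffun i => f i].
    by apply/forallP => i; rewrite ffunE; case: (hf i) => _ -> _ ->.
  apply/andP; split.
    apply/bigcupsP => i _; rewrite ffunE; have [fI _ _ _] := hf i.
    exact: subset_trans fI (IS i).
  rewrite -setI_eq0 -subset0; apply/subsetP => v; rewrite inE => /andP[/cov[i vI] /bigcapP/(_ i isT)].
  by rewrite ffunE => vD; have [_ _ dis _] := hf i; case: (disjoint_meetF dis vD vI).
apply: (@le_trans _ _ (\sum_(F | K F) q ^+ #|\bigcup_i F i| * wz)).
  apply: ler_sum => F /forallP KF; apply: le_trans (sum_keep_between q01 _ _) _.
  by rewrite ler_wpM2l ?exprn_ge0 // hz // => i; case/andP: (KF i).
rewrite -mulr_suml mulrC ler_wpM2l //.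
have y0 : 0 <= 2 ^+ r * q by rewrite mulr_ge0 ?exprn_ge0.
apply: le_trans (sum_exp_card _ _ y0 la1).
rewrite (partition_big (fun F : {ffun 'I_r -> {set vert H}} => \bigcup_i F i)
  (fun T : {set vert H} => (#|T| <= r * h)%N)) /=; last first.
  move=> F /forallP KF; apply: (@leq_trans (\sum_i #|F i|)%N).
    elim/big_rec2: _ => [|i n U _ le]; first by rewrite cards0.
    by apply: leq_trans (leq_card_setU _ _) _; rewrite leq_add2l.
  apply: (@leq_trans (\sum_(i < r) h)%N); last by rewrite sum_nat_const card_ord.
  by apply: leq_sum => i _; case/andP: (KF i).
apply: ler_sum => T _.
apply: (@le_trans _ _ (\sum_(F in (ffun_on (mem (powerset T)) : simpl_pred {ffun 'I_r -> {set vert H}})) q ^+ #|T|)).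
  rewrite [leRHS](bigID (fun F : {ffun 'I_r -> {set vert H}} => K F && (\bigcup_i F i == T))) /=.
  apply: ler_wpDr; first by apply: sumr_ge0 => F _; rewrite exprn_ge0.
  rewrite le_eqVlt; apply/orP; left; apply/eqP; apply: eq_big => [F|F /andP[_ /eqP->]//].
  case: (K F) => /=; last by rewrite andbF.
  case: eqP => [<-|_]; last by rewrite andbF.
  by apply/esym; rewrite andbT; apply/ffun_onP => i; rewrite inE bigcup_sup.
rewrite sumr_const card_ffun_on card_ord card_powerset -[leLHS]mulr_natl exprMn.
by rewrite -exprM !natrX -exprM mulnC.
Qed.
End Supersaturation.

(** * Constants of the two thresholds *)

Section Threshold.
Variables (R : realType) (k : nat).
Implicit Types (H : ohgraph k) (W X : {set 'I_k}).

Lemma fW_le_phat H W : (2 <= #|W|)%N -> fW R H W <= phat R H.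
Proof.
by move=> hW; rewrite /phat; apply: (le_bigmax_cond _ (fun W => fW R H W)).
Qed.

Lemma phat_edges H : 0 < phat R H -> edges H != set0.
Proof.
apply: contraTneq => E0; rewrite -leNgt; apply: bigmax_le => // W hW.
have -> : fW R H W = 0; last by [].
rewrite /fW (_ : edges (restr H W) = set0) ?cards0 ?mul0r ?powR0 //.
  by rewrite oppr_eq0 invr_eq0 subr_eq0 pnatr_eq1; case: #|W| hW => [|[]].
by rewrite /= E0 imset0.
Qed.

Lemma fW_exp H W : edges H != set0 -> (2 <= #|W|)%N ->
  fW R H W ^+ #|W|.-1 = #|vert H|%:R / #|edges (restr H W)|%:R.
Proof.
move=> E0 hW; have e0 := card_restr_gt0 W E0.
have w0 : #|W|.-1%:R != 0 :> R by rewrite pnatr_eq0; case: #|W| hW => [|[]].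
rewrite /fW -powR_mulrn ?powR_ge0 // -powRrM.
have -> : #|W|%:R - 1 = #|W|.-1%:R :> R.
  by rewrite -[in LHS](prednK (ltnW hW)) -natr1 addrK.
by rewrite mulNr mulVf // powR_inv1 ?invf_div // divr_ge0.
Qed.

Lemma fW_ge0 H W : 0 <= fW R H W.
Proof. exact: powR_ge0. Qed.

(** By [fW_exp], the inequality [fW <= phat] reads [v(H) / e(H_A) <= phat ^+ #|A|.-1], which turns
    (P3) into the geometric degree bound; singletons are covered by (P4). *)
Lemma deg_bound_Delta H (b : R) : 0 < b -> (2 <= k)%N -> 0 < phat R H ->
  (forall W, (Delta H W setT)%:R
     <= b * (#|edges (restr H setT)|%:R / #|edges (restr H W)|%:R)) ->
  (forall W, #|W| = 1%N -> (Delta H W setT)%:R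
     <= b * (#|edges (restr H setT)|%:R / #|vert H|%:R)) ->
  deg_bound (phat R H) setT (edges H) (b * (#|edges H|%:R / #|vert H|%:R)).
Proof.
move=> b0 k2 ph0 h3 h4 A e _ A0; have E0 := phat_edges ph0.
have [e0 e0E] := set0Pn _ E0.
have V0 : 0 < #|vert H|%:R :> R.
  by rewrite ltr0n; apply/card_gt0P; exists (e0 (Ordinal (ltnW k2))).
have cT : #|edges (restr H setT)|%:R <= #|edges H|%:R :> R by rewrite ler_nat card_restr_le.
apply: (@le_trans _ _ (Delta H A setT)%:R); first by rewrite ler_nat deg_le_Delta.
have [A1|A2] := leqP #|A| 1.
  have {}A1 : #|A| = 1%N by apply/eqP; rewrite eqn_leq A1 card_gt0.
  rewrite A1 expr0 mulr1; apply: le_trans (h4 A A1) _.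
  by rewrite ler_pM2l // ler_pM2r ?invr_gt0.
apply: le_trans (h3 A) _; rewrite -!mulrA ler_pM2l //.
have eA : 0 < #|edges (restr H A)|%:R :> R by rewrite ltr0n card_restr_gt0.
apply: (@le_trans _ _ (#|edges H|%:R / #|edges (restr H A)|%:R)).
  by rewrite ler_pM2r ?invr_gt0.
rewrite ler_wpM2l //.
have : fW R H A ^+ #|A|.-1 <= phat R H ^+ #|A|.-1.
  by rewrite lerXn2r ?nnegrE ?fW_ge0 ?(ltW ph0) // fW_le_phat.
by rewrite fW_exp // ler_pdivlMl // mulrC.
Qed.

Lemma one_minus_exp (q : R) n : q <= 1 -> (1 - q) ^+ n <= expR (- q * n%:R).
Proof.
move=> q1; rewrite expRM_natr lerXn2r ?nnegrE ?subr_ge0 ?(ltW (expR_gt0 _)) //.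
exact: expR_ge1Dx.
Qed.

Lemma not_Ramsey_rare r (eps b : R) : (2 <= k)%N -> (2 <= r)%N -> 0 < eps -> 0 < b ->
  exists C p0 zeta : R, [/\ 0 < C, 0 < p0, 0 < zeta &
  forall H (p q : R), 0 <= q <= 1 -> 0 < p <= p0 -> 1 <= p * #|vert H|%:R ->
    C * p <= q -> edges H != set0 -> supersaturated r eps H ->
    deg_bound p setT (edges H) (b * (#|edges H|%:R / #|vert H|%:R)) ->
    \sum_(S : {set vert H} | ~~ Ramsey r (induced S)) keep_weight q S
    <= expR (- (zeta * (p * #|vert H|%:R)))].
Proof.
move=> k2 r2 eps0 b0.
have k0 : (0 < k)%N by apply: ltnW.
have r0 : (0 < r)%N by apply: ltnW.
have rR0 : 0 < r%:R :> R by rewrite ltr0n.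
have kR0 : 0 < k%:R :> R by rewrite ltr0n.
(* Half of [eps] remains for the monochromatic edges meeting the intersection of the sets [D], which
   then has at least [z0 * N] vertices. *)
pose delta := eps / (2 * r%:R).
have de0 : 0 < delta by rewrite divr_gt0 // mulr_gt0.
have [c0 [p0 p00 cont]] := containers k0 b0 de0.
pose z0 := eps / (2 * (k%:R * b)).
have z00 : 0 < z0 by rewrite divr_gt0 // !mulr_gt0.
(* Since [expR a >= a], taking [la = expR a] bounds [2 ^+ r * q / la] by [q * z0 / 2]: this factor
   uses up half of the gain [z0 * q * N]. *)
pose a := 2 ^+ r.+1 / z0.
have a0 : 0 < a by rewrite divr_gt0 // exprn_gt0.
(* With [m <= 2 * p * N], the factor [la ^+ (r * (c0 * m))] uses up at most another quarter of the
   gain. The last quarter gives [z0 / 4], and the summand 1 ensures [q >= p]. *)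
pose C := 8 * a * (r * c0)%:R / z0 + 1.
have C1 : 1 <= C by rewrite lerDr divr_ge0 ?(ltW z00) // mulr_ge0 // mulr_ge0 // ltW.
exists C, p0, (z0 / 4); split=> //; [exact: lt_le_trans C1 | by rewrite divr_gt0 |].
move=> H p q q01 hp pN1 Cq E0 ss dE; case/andP: (q01) => q0 q1.
set N := #|vert H|%:R in pN1 dE *.
have N0 : 0 <= N by [].
have pN0 : 0 <= p * N by apply: le_trans pN1.
(* Rounding [p * N] up stays below [2 * p * N] because [1 <= p * N]. *)
pose m := (Num.truncn (p * N)).+1.
have hm : p * N <= m%:R <= 2 * p * N.
  have /andP[t1 t2] := truncn_itv pN0; rewrite (ltW t2) /= -mulrA.
  by rewrite /m -natr1; lra.
have [D hD] := cont _ p m (edges H) hp hm isT E0 dE.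
pose good (Z : {set vert H}) := #|avoiding (edges H) Z|%:R <= delta * #|edges H|%:R.
pose wz := expR (- q * (z0 * N)).
have la1 : 1 <= expR a by apply: le_trans (expR_ge1Dx _); rewrite lerDl ltW.
have aE : a <= expR a by apply: le_trans (expR_ge1Dx _); rewrite lerDr.
have wz0 : 0 <= wz by rewrite ltW // expR_gt0.
apply: le_trans (@prob_not_Ramsey_le _ _ _ _ q01 r D good (c0 * m) (expR a) wz la1 wz0 _ _) _.
- by move=> I hI; have [S [h1 h2 h3 h4]] := hD I hI; exists S.
- move=> F gF; apply: le_trans (one_minus_exp _ q1) _.
  rewrite ler_expR ler_wnM2l ?oppr_le0 //.
  have h : (eps - r%:R * delta) * N <= k%:R * b * #|\bigcap_i D (F i)|%:R.
    have := @uncovered_large _ _ _ r eps b delta p [ffun i => D (F i)] k0 r0 b0 E0 ss dE.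
    rewrite (eq_bigr (fun i => D (F i))) => [|i _]; last by rewrite ffunE.
    by apply=> i; rewrite ffunE; apply: gF.
  have kb0 : 0 < k%:R * b by rewrite mulr_gt0.
  rewrite -(ler_pM2l kb0); apply: le_trans h; rewrite le_eqVlt; apply/orP; left; apply/eqP.
  by rewrite /z0 /delta; field; rewrite !gt_eqF.
have y2 : 2 ^+ r * q / expR a <= q * z0 / 2.
  apply: (@le_trans _ _ (2 ^+ r * q / a)).
    apply: ler_wpM2l; first by rewrite mulr_ge0 ?exprn_ge0.
    by rewrite lef_pV2 ?posrE ?expR_gt0.
  rewrite le_eqVlt; apply/orP; left; apply/eqP; rewrite /a exprS; field.
  by rewrite (gt_eqF z00) /= expf_neq0 // pnatr_eq0.
apply: (@le_trans _ _ (wz * (expR (a * (r * (c0 * m))%:R) * expR (q * z0 / 2 * N)))).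
  apply: ler_wpM2l => //; rewrite -expRM_natr; apply: ler_wpM2l; first exact/ltW/expR_gt0.
  rewrite expRM_natr lerXn2r ?nnegrE ?(ltW (expR_gt0 _)) //.
    by rewrite addr_ge0 // mulr_ge0 ?invr_ge0 ?(ltW (expR_gt0 _)) // mulr_ge0 ?exprn_ge0.
  by apply: le_trans (expR_ge1Dx _); rewrite lerD2l.
rewrite /wz -!expRD ler_expR.
have -> : (r * (c0 * m))%:R = (r * c0)%:R * m%:R :> R by rewrite mulnA natrM.
have m2 : a * ((r * c0)%:R * m%:R) <= a * (r * c0)%:R * (2 * p * N).
  by rewrite mulrA; apply: ler_wpM2l; [rewrite mulr_ge0 // ltW | case/andP: hm].
have qN : (8 * a * (r * c0)%:R / z0 + 1) * p * N <= q * N by rewrite ler_wpM2r.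
have h1 : 8 * (a * (r * c0)%:R * p * N) + z0 * (p * N) <= z0 * (q * N).
  have -> : 8 * (a * (r * c0)%:R * p * N) + z0 * (p * N) =
    z0 * ((8 * a * (r * c0)%:R / z0 + 1) * p * N) by field; rewrite gt_eqF.
  by rewrite ler_pM2l.
have -> : - q * (z0 * N) + (a * ((r * c0)%:R * m%:R) + q * z0 / 2 * N) =
  a * ((r * c0)%:R * m%:R) - z0 * (q * N) / 2 by field.
have m3 : a * (r * c0)%:R * (2 * p * N) = 2 * (a * (r * c0)%:R * p * N) by ring.
rewrite m3 in m2.
have z1 : 0 <= z0 * (p * N) by rewrite mulr_ge0 // ltW.
have t0 : 0 <= a * (r * c0)%:R * p * N.
  by rewrite -mulrA mulr_ge0 // mulr_ge0 // ltW.
move: (a * ((r * c0)%:R * m%:R)) (a * (r * c0)%:R * p * N) (z0 * (q * N)) m2 h1 t0 => x1 x2 x3 m2 h1 t0.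
have -> : z0 / 4 * (p * N) = z0 * (p * N) / 4 by field.
by move: (z0 * (p * N)) h1 z1 => x4 h1 z1; lra.
Qed.

Lemma Ramsey_rare X H r (q : R) : (2 <= r)%N -> 0 <= q <= 1 ->
  \sum_(S : {set vert H} | Ramsey r (induced S)) keep_weight q S <=
  \sum_(S : {set vert H} | ~~ colourable (inside (shadow H X) S)) keep_weight q S.
Proof.
move=> r2 q01; rewrite [leRHS](bigID (fun S => Ramsey r (induced S))) /=.
apply: ler_wpDr; first by apply: sumr_ge0 => S _; apply: keep_weight_ge0.
rewrite le_eqVlt; apply/orP; left; apply/eqP; apply: eq_bigl => S.
case RS: (Ramsey r (induced S)); last by rewrite andbF.
by rewrite andbT; apply/esym; apply: contraL RS; apply: colourable_not_Ramsey.
Qed.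

Definition spread_const := (2 ^ k * k ^ k)%N.

Lemma Ramsey_rare_sparse X H r (b a c q t : R) : (2 <= r)%N -> 0 <= q <= 1 ->
  (3 <= #|X|)%N -> 0 < b -> 0 < a -> 0 < phat R H ->
  0 < c -> c <= 1 -> c <= a ->
  (k * spread_const)%:R * 2 ^+ (2 * k).+1 * b * c / a <= 2^-1 ->
  q <= c * phat R H -> a * phat R H <= fW R H X ->
  (forall W, W \proper X -> #|W| = 1%N ->
     (Delta H W X)%:R <= b * (#|edges (restr H X)|%:R / #|vert H|%:R)) ->
  0 <= t ->
  (forall W W', W \proper X -> W' \proper X -> #|W| = 2%N -> (2 <= #|W'|)%N ->
     (Delta H W X)%:R * (Delta H W' X)%:R * #|edges (restr H X)|%:R
       * phat R H ^+ (3 * #|X| - 2 - #|W'|) <= t) ->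
  \sum_(S : {set vert H} | Ramsey r (induced S)) keep_weight q S
  <= (8 * k ^ 2 * (4 * k) ^ (2 * k).+1)%:R * ((spread_const ^ 2)%:R * t).
Proof.
move=> r2 q01 X3 b0 a0 ph0 c0 c1 ca small qc aX h1 t0 h2.
case/andP: (q01) => q0 q1; set x := #|X| in X3 h2 *.
have xk : (x <= k)%N by rewrite -[leqRHS]card_ord max_card.
have x0 : (0 < x)%N by apply: leq_trans X3.
have k0 : (0 < k)%N by apply: leq_trans xk.
have E0 := phat_edges ph0; have [e0 e0E] := set0Pn _ E0.
have V0 : 0 < #|vert H|%:R :> R.
  by rewrite ltr0n; apply/card_gt0P; exists (e0 (Ordinal k0)).
have eX : 0 < #|edges (restr H X)|%:R :> R by rewrite ltr0n card_restr_gt0.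
pose D w : R := (spread_const * max_Delta H X w)%:R.
have D0 w : 0 <= D w by [].
have degX (A : {set vert H}) : (0 < #|A| < x)%N ->
    #|[set g in shadow H X | A \subset g]|%:R <= D #|A|.
  by move=> _; rewrite ler_nat shadow_deg.
have uX g : g \in shadow H X -> #|g| = x by apply: shadow_card.
have gr0 w : 0 <= growth q x D w by rewrite mulr_ge0 ?exprn_ge0.
have maxD w : (w <= x)%N -> exists2 W : {set 'I_k}, (W \subset X) && (#|W| == w)
    & max_Delta H X w = Delta H W X.
  move=> wx; have : (0 < #|[pred W : {set 'I_k} | (W \subset X) && (#|W| == w)]|)%N.
    by rewrite -cardsE cards_draws bin_gt0.
  by case/(eq_bigmax_cond (fun W => Delta H W X))=> W hW eW; exists W.
have qp : q <= phat R H by apply: le_trans qc _; rewrite ger_pMl.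
(* Path steps are subcritical: (P4) bounds vertex degrees by [b * e(H_X) / v(H)], while
   [a * phat <= fW] bounds [q ^+ x.-1] by [(c / a) ^+ x.-1 * v(H) / e(H_X)]. As [c / a <= 1], a
   single factor [c / a] is kept. *)
have g1b : growth q x D 1 <= spread_const%:R * b * c / a.
  have [W /andP[WX /eqP W1] eW] := maxD 1%N x0.
  have WpX : W \proper X.
    by rewrite properEcard WX W1; apply: ltn_trans X3.
  rewrite /growth /D natrM eW subn1 -!mulrA ler_wpM2l //.
  apply: (@le_trans _ _ (b * (#|edges (restr H X)|%:R / #|vert H|%:R) * q ^+ x.-1)).
    by rewrite ler_wpM2r ?exprn_ge0 ?h1.
  rewrite -mulrA ler_pM2l //.
  have hX : (a * phat R H) ^+ x.-1 <= #|vert H|%:R / #|edges (restr H X)|%:R.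
    rewrite -fW_exp //; last by apply: ltn_trans X3.
    by rewrite lerXn2r ?nnegrE ?fW_ge0 // mulr_ge0 // ltW.
  have ap : 0 < (a * phat R H) ^+ x.-1 by rewrite exprn_gt0 // mulr_gt0.
  have hq : q ^+ x.-1 <= (c / a) ^+ x.-1 * (a * phat R H) ^+ x.-1.
    rewrite -exprMn lerXn2r ?nnegrE //.
      by rewrite mulr_ge0 // ?divr_ge0 // ?mulr_ge0 // ltW.
    by rewrite mulrA divfK ?gt_eqF.
  have ca0 : 0 <= c / a by rewrite divr_ge0 // ltW.
  apply: (@le_trans _ _ ((c / a) ^+ x.-1)).
    rewrite mulrC; apply: le_trans (ler_wpM2r _ hq) _; first by rewrite divr_ge0.
    rewrite -[leRHS]mulr1 -mulrA ler_wpM2l ?exprn_ge0 //.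
    by rewrite -ler_pdivlMr ?divr_gt0 // div1r invf_div.
  have ca1 : c / a <= 1 by rewrite ler_pdivrMr // mul1r.
  have -> : x.-1 = x.-2.+1 by case: (x) X3 => [|[]].
  rewrite exprS -[leRHS]mulr1 ler_wpM2l // exprn_ile1 //.
have g1 : x%:R * growth q x D 1 * 2 ^+ (2 * x).+1 <= 2^-1.
  apply: le_trans small.
  rewrite natrM.
  have -> : k%:R * spread_const%:R * 2 ^+ (2 * k).+1 * b * c / a =
    k%:R * (spread_const%:R * b * c / a) * 2 ^+ (2 * k).+1 by ring.
  apply: ler_pM; rewrite ?mulr_ge0 ?exprn_ge0 //.
    by apply: ler_pM; rewrite ?ler_nat.
  by rewrite ler_weXn2l ?ler1n // ltnS leq_mul2l xk.
have g11 : growth q x D 1 <= 1.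
  have : growth q x D 1 <= x%:R * growth q x D 1 * 2 ^+ (2 * x).+1.
    rewrite mulrAC ler_peMl // -[leLHS]mulr1 ler_pM // ?ler1n //.
    by rewrite exprn_ege1 // ler1n.
  by move=> /le_trans/(_ g1)/le_trans; apply; lra.
apply: le_trans (Ramsey_rare X H r2 q01) _.
have d0 : 0 <= (spread_const ^ 2)%:R * t by rewrite mulr_ge0.
apply: le_trans (sum_keep_noncolourable q01 uX degX X3 (fun a _ => gr0 a) g11 g1 d0 _) _; last first.
  rewrite ler_wpM2r // ler_nat leq_mul //; first by rewrite leq_mul2l /= leq_exp2r.
  apply: (@leq_trans ((4 * k) ^ (2 * x).+1)%N); first by rewrite leq_exp2r // leq_mul2l.
  by rewrite leq_pexp2l ?muln_gt0 ?k0 // ltnS leq_mul2l xk.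
have main w : (2 <= w < x)%N ->
    #|shadow H X|%:R * q ^+ x * growth q x D 2 * growth q x D w <= (spread_const ^ 2)%:R * t.
  case/andP=> w2 wx.
  have [W /andP[WX /eqP cW] eW] := maxD 2%N (ltnW X3).
  have [W' /andP[WX' /eqP cW'] eW'] := maxD w (ltnW wx).
  have WpX : W \proper X by rewrite properEcard WX cW.
  have WpX' : W' \proper X by rewrite properEcard WX' cW'.
  have := h2 W W' WpX WpX' cW; rewrite cW' => /(_ w2) h.
  apply: (@le_trans _ _ ((spread_const ^ 2)%:R * ((Delta H W X)%:R * (Delta H W' X)%:R
    * #|edges (restr H X)|%:R * phat R H ^+ (3 * x - 2 - w)))); last by rewrite ler_wpM2l.
  rewrite /growth /D eW eW'; move: spread_const => sc; rewrite (natrX _ sc) !(natrM _ sc).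
  (* The starting edge, the edge attached in 2 vertices and the one attached in [w] vertices bring
     [x], [x - 2] and [x - w] new vertices. *)
  have -> : (3 * x - 2 - w = x + (x - 2) + (x - w))%N.
    by move: (x) wx w2 X3; clear => n; lia.
  set s := sc%:R; set d := (Delta H W X)%:R; set d' := (Delta H W' X)%:R.
  have -> : #|shadow H X|%:R * q ^+ x * (s * d * q ^+ (x - 2)) * (s * d' * q ^+ (x - w)) =
    (s * s) * ((d * d' * #|shadow H X|%:R) * q ^+ (x + (x - 2) + (x - w))).
    by rewrite !exprD; ring.
  rewrite expr2 ler_wpM2l ?mulr_ge0 //.
  apply: ler_pM; rewrite ?mulr_ge0 ?exprn_ge0 //.
    by rewrite ler_wpM2l ?mulr_ge0 // ler_nat card_shadow.
  by rewrite lerXn2r ?nnegrE // ltW.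
move=> u v hu hv /orP[]/eqP e2.
  by rewrite e2; apply: main.
by rewrite e2 mulrAC; apply: main.
Qed.
Lemma prob_keep_compl H r (q : R) :
  1 - prob_keep H q (@Ramsey k r) =
  \sum_(S : {set vert H} | ~~ Ramsey r (induced S)) keep_weight q S.
Proof.
by rewrite -(sum_keep_weight H q) (bigID (fun S => Ramsey r (induced S))) /= addrC addrK.
Qed.

Lemma expRN_le (y e : R) : 0 < e -> e^-1 <= y -> expR (- y) <= e.
Proof.
move=> e0 ey; have y0 : 0 < y by apply: lt_le_trans ey; rewrite invr_gt0.
rewrite expRN -[leRHS]invrK lef_pV2 ?posrE ?expR_gt0 ?invr_gt0 //.
by apply: le_trans ey _; apply: le_trans (expR_ge1Dx _); rewrite lerDr.
Qed.

End Threshold.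

(* From finite estimates to limits *)
From mathcomp Require Import all_classical all_reals all_analysis.
Import Order.TTheory GRing.Theory Num.Theory numFieldNormedType.Exports.
Local Open Scope classical_set_scope.
Local Open Scope ring_scope.

Theorem theorem7p7 (R : realType) (r k : nat) (b : R) (Hn : nat -> ohgraph k)
    (hr : (2 <= r)%N) (hk : (2 <= k)%N) (hb : 0 < b) :
  (P1 R Hn -> P2 R Hn r -> P3 Hn b -> P4 Hn b ->
    exists2 C : R, 0 < C &
      forall q : nat -> R, (forall n, 0 <= q n <= 1) ->
        (\forall n \near \oo, C * phat R (Hn n) <= q n) ->
        prob_keep (Hn n) (q n) (@Ramsey k r) @[n --> \oo] --> (1 : R))
  /\
  (P1 R Hn -> P3 Hn b -> P4 Hn b -> P5 R Hn ->
    exists2 c : R, 0 < c &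
      forall q : nat -> R, (forall n, 0 <= q n <= 1) ->
        (\forall n \near \oo, q n <= c * phat R (Hn n)) ->
        prob_keep (Hn n) (q n) (@Ramsey k r) @[n --> \oo] --> (0 : R)).
Proof.
have allnear (T : finType) (P : T -> nat -> Prop) :
    (forall t, \forall n \near \oo, P t n) -> \forall n \near \oo, forall t, P t n.
  by move=> h; apply: filter_forall.
split.
  move=> [ph0 phN] [eps eps0 [n0 ss]] h3 h4.
  have [C [p0 [zeta [C0 p00 z0 rare]]]] := not_Ramsey_rare hk hr eps0 hb.
  exists C => // q q01 Cq; apply/cvgrPdist_le => e e0.
  have N3 : \forall n \near \oo, forall W : {set 'I_k}, (Delta (Hn n) W [set: 'I_k]%SET)%:R
      <= b * (#|edges (restr (Hn n) [set: 'I_k]%SET)|%:R / #|edges (restr (Hn n) W)|%:R).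
    by apply: allnear => W; apply: h3; apply: finset.subsetT.
  have N4 : \forall n \near \oo, forall W : {set 'I_k}, #|W| = 1%N ->
      (Delta (Hn n) W [set: 'I_k]%SET)%:R
      <= b * (#|edges (restr (Hn n) [set: 'I_k]%SET)|%:R / #|vert (Hn n)|%:R).
    apply: allnear => W; have [W1|W1] := eqVneq #|W| 1%N; last first.
      by near=> n => W1'; rewrite W1' in W1.
    have WT : W \proper [set: 'I_k]%SET.
      by rewrite finset.properEcard finset.subsetT W1 cardsT card_ord.
    by near=> n => _; near: n; apply: h4.
  near=> n.
  (* The entry 1 forces [phat > 0] and permits the rounding of [p * N]; the other one brings the
     exponential bound below [e]. *)
  have pN : Num.max 1 (zeta * e)^-1 <= phat R (Hn n) * #|vert (Hn n)|%:R.
    by near: n; move/cvgryPge: phN; apply.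
  rewrite ge_max in pN; case/andP: pN => pN1 pNe.
  have p_gt0 : 0 < phat R (Hn n).
    rewrite ltNge; apply/negP => ple; have := le_trans pN1 (mulr_le0_ge0 ple (ler0n _ _)).
    by rewrite ler10.
  have ple : phat R (Hn n) <= p0.
    have : `|0 - phat R (Hn n)| <= p0 by near: n; move/cvgrPdist_le: ph0; apply.
    by rewrite sub0r normrN ger0_norm // ltW.
  have dE := deg_bound_Delta hb hk p_gt0 (near N3 n _) (near N4 n _).
  have sn : supersaturated r eps (Hn n) by apply: ss; near: n; apply: nbhs_infty_ge.
  have hp : 0 < phat R (Hn n) <= p0 by rewrite p_gt0.
  rewrite prob_keep_compl ger0_norm; last first.
    by apply: sumr_ge0 => S _; apply: keep_weight_ge0.
  apply: le_trans (rare (Hn n) _ _ (q01 n) hp pN1 _ (phat_edges p_gt0) sn _) _.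
  - by near: n.
  - exact: dE.
  apply: expRN_le => //; rewrite -ler_pdivrMl // -invfM mulrC.
  by rewrite mulrC.
move=> [ph0 phN] _ h4 [X [X3 [a a0 aX] lim]].
pose K : R := (k * spread_const k)%:R * 2 ^+ (2 * k).+1 * b.
have K0 : 0 < K.
  rewrite !mulr_gt0 ?exprn_gt0 // ltr0n !muln_gt0 !expn_gt0 /=.
  by rewrite (ltnW hk).
(* The entry 1 gives [q <= phat], the entry [a] gives [c / a <= 1], and the last one gives
   [K * c / a <= 1/2], the subcriticality of loose paths. *)
pose c := Num.min 1 (Num.min a (a / (2 * K))).
have c0 : 0 < c by rewrite !lt_min ltr01 a0 /= divr_gt0 // mulr_gt0.
have c1 : c <= 1 by rewrite ge_min lexx.
have ca : c <= a by rewrite !ge_min lexx !orbT.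
have cK : c <= a / (2 * K) by rewrite !ge_min lexx !orbT.
exists c => // q q01 qc.
pose cost n (w : {set 'I_k} * {set 'I_k}) : R :=
  (Delta (Hn n) w.1 (X n))%:R * (Delta (Hn n) w.2 (X n))%:R
    * #|edges (restr (Hn n) (X n))|%:R * phat R (Hn n) ^+ (3 * #|X n| - 2 - #|w.2|).
pose ok n (w : {set 'I_k} * {set 'I_k}) :=
  [&& w.1 \proper X n, w.2 \proper X n, #|w.1| == 2%N & (2 <= #|w.2|)%N].
(* (P5) concerns sequences of pairs, whereas the estimate at [n] requires all pairs at once. The
   sequence of the costliest pairs bounds them all by one null sequence. *)
have : forall n, exists w, ok n w /\ forall w', ok n w' -> cost n w' <= cost n w.
  move=> n.
  have [W] : exists W : {set 'I_k}, (W \subset X n) && (#|W| == 2%N).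
    have : (0 < #|[set A : {set 'I_k} | A \subset X n & #|A| == 2%N]%SET|)%N.
      by rewrite cards_draws bin_gt0 ltnW.
    by case/card_gt0P=> W; rewrite finset.inE => h; exists W.
  case/andP=> WX /eqP W2.
  have ok0 : ok n (W, W) by rewrite /ok /= finset.properEcard WX W2 X3.
  by case: (@Order.TotalTheory.arg_maxP _ _ _ (W, W) (ok n) (cost n) ok0) => w okw mx; exists w.
move=> /choice[w hw].
have v0 : cost n (w n) @[n --> \oo] --> (0 : R).
  apply: (lim (fun n => (w n).1) (fun n => (w n).2)) => n.
  by have [/and4P[-> -> /eqP-> ->] _] := hw n.
have ph_ge0 n : 0 <= phat R (Hn n) by apply: bigmax_ge_id.
have cost_ge0 n x : 0 <= cost n x by rewrite mulr_ge0 ?exprn_ge0.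
pose M : R := (8 * k ^ 2 * (4 * k) ^ (2 * k).+1)%:R * (spread_const k ^ 2)%:R + 1.
have M0 : 0 < M by rewrite ltr_wpDl // mulr_ge0.
apply/cvgrPdist_le => e e0.
(* As [X n] varies with [n], (P4) is made uniform over the finitely many pairs of position sets. *)
have N4 : \forall n \near \oo, forall WY : {set 'I_k} * {set 'I_k},
    WY.1 \proper WY.2 -> #|WY.1| = 1%N ->
    (Delta (Hn n) WY.1 WY.2)%:R
      <= b * (#|edges (restr (Hn n) WY.2)|%:R / #|vert (Hn n)|%:R).
  apply: allnear => -[W Y] /=.
  have [WY|WY] := boolP (W \proper Y); last by near=> n.
  have [W1|W1] := eqVneq #|W| 1%N; last by near=> n => _ W1'; rewrite W1' in W1.
  by near=> n => _ _; near: n; apply: h4.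
near=> n.
have pN : 1 <= phat R (Hn n) * #|vert (Hn n)|%:R.
  by near: n; move/cvgryPge: phN; apply.
have p_gt0 : 0 < phat R (Hn n).
  rewrite lt_neqAle ph_ge0 andbT eq_sym; apply: contraTneq pN => ->.
  by rewrite mul0r ler10.
have vn : cost n (w n) <= e / M.
  have : `|0 - cost n (w n)| <= e / M.
    by near: n; move/cvgrPdist_le: v0; apply; rewrite divr_gt0.
  by rewrite sub0r normrN ger0_norm.
rewrite sub0r normrN ger0_norm; last by apply: sumr_ge0 => S _; apply: keep_weight_ge0.
apply: le_trans (@Ramsey_rare_sparse R k (X n) (Hn n) r b a c (q n) (cost n (w n))
  hr (q01 n) (X3 n) hb a0 p_gt0 c0 c1 ca _ _ _ _ _ _) _.
- rewrite -/K; rewrite ler_pdivrMr // -ler_pdivlMl //.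
  by apply: le_trans cK _; rewrite invfM mulrC -mulrA mulrCA.
- by near: n.
- by near: n.
- by move=> W WX W1; apply: (near N4 n _ (W, X n)).
- exact: cost_ge0.
- move=> W W' h1 h2 h3' h4'; have [_ /(_ (W, W'))] := hw n; apply.
  by rewrite /ok /= h1 h2 h3' h4'.
rewrite mulrA; apply: (@le_trans _ _ (M * (e / M))).
  by apply: ler_pM => //; rewrite lerDl.
by rewrite mulrCA divff ?mulr1 // gt_eqF.
Unshelve. all: by end_near.
Qed.
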